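(* Let $n\in\{2,3\}$, let $\Omega\subset\mathbb{R}^n$ be a bounded Lipschitz domain with outward unit normal $\nu$ on $\partial\Omega$, let $k>0$, and let $f\in L^2(\mathbb{R}^n)$ be real-valued with compact support in $\Omega$. Let $u(x,k)=\int_\Omega \Phi_k(x,y)f(y)\,dy$ be the radiated wave and, for $z\in\mathbb{R}^n$, let $$\mathcal{I}_{k}(z) = \int_{\partial \Omega} \left(\frac{\partial \operatorname{Im}\Phi_k(x,z)}{\partial\nu(x)}\,u(x,k) - \operatorname{Im}\Phi_k(x,z)\,\frac{\partial u(x,k)}{\partial\nu(x)}\right) dS(x).$$ Then there is a constant $C>0$, independent of $z$ and $\delta$, such that the following holds. For every $\delta>0$ and all noisy data $u_\delta(\cdot,k)$, $\frac{\partial u_\delta(\cdot,k)}{\partial\nu}$ on $\partial\Omega$ satisfying $$\| u(\cdot,k) - u_\delta (\cdot,k)\|_{L^2(\partial \Omega)} \leq \delta \quad\text{and}\quad \left\| \frac{\partial u(\cdot,k)}{\partial\nu} - \frac{\partial u_\delta(\cdot,k)}{\partial\nu}\right\|_{L^2(\partial \Omega)} \leq \delta,$$ the noisy imaging function $$\mathcal{I}_{k,\delta}(z) = \int_{\partial \Omega} \left(\frac{\partial \operatorname{Im}\Phi_k(x,z)}{\partial\nu(x)}\,u_\delta(x,k) - \operatorname{Im}\Phi_k(x,z)\,\frac{\partial u_\delta(x,k)}{\partial\nu(x)}\right) dS(x)$$ satisfies $$|\mathcal{I}_k(z)- \mathcal{I}_{k,\delta}(z) |\leq C \delta \quad \text{for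 all } z \in \mathbb{R}^n.$$
   Context: $\Phi_k$ is the outgoing Green's function of the Helmholtz operator: for $x\neq y$ in $\mathbb{R}^n$, $$\Phi_k(x,y)=\begin{cases}\frac{i}{4}H_0^{(1)}(k|x-y|), & n=2,\\ \frac{\exp(ik|x-y|)}{4\pi|x-y|}, & n=3,\end{cases}$$ where $H_0^{(1)}$ is the Hankel function of the first kind of order zero. Its imaginary part extends smoothly across $x=y$ and equals $\frac14 J_0(k|x-y|)$ for $n=2$ and $\frac{k}{4\pi}j_0(k|x-y|)$ for $n=3$, where $J_0$ is the Bessel function of the first kind of order $0$ and $j_0(t)=\sin(t)/t$ (with $j_0(0)=1$). The noisy data $u_\delta(\cdot,k)$ and $\frac{\partial u_\delta(\cdot,k)}{\partial\nu}$ are complex-valued functions in $L^2(\partial\Omega)$ (perturbed Cauchy data). *)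

(* Defs.v *)
From HB Require Import structures.
From mathcomp Require Import all_boot all_order all_algebra.
From mathcomp Require Import all_classical all_reals all_analysis.
From mathcomp Require Import complex.
From mathcomp Require Import ring.

Set Implicit Arguments.
Unset Strict Implicit.
Unset Printing Implicit Defensive.

Import Order.TTheory GRing.Theory Num.Theory.
Import numFieldNormedType.Exports.

Local Open Scope classical_set_scope.
Local Open Scope ring_scope.

(* The library norm on 'rV[R]_n is the sup norm.  It induces the usual
   topology, bounded sets and Lipschitz functions, but all lengths, balls and
   diameters below are Euclidean. *)
Definition enorm (R : realType) n (v : 'rV[R]_n) : R :=
  Num.sqrt (\sum_(i < n) v 0 i ^+ 2).

Definition eball (R : realType) n (p : 'rV[R]_n) (r : R) : set 'rV[R]_n :=
  [set x | enorm (x - p) < r].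

Definition frontier (T : topologicalType) (A : set T) : set T :=
  closure A `\` interior A.

(* Lebesgue and Hausdorff measure on R^n are the Caratheodory measures of the
   outer measures given by countable covers.  Measurability always refers to
   the (complete) Caratheodory sigma-algebra, which contains the Borel sets. *)

Definition cara_measure (R : realType) (T : pointedType)
    (mu : {outer_measure set T -> \bar R}) :
    {measure set (caratheodory_type mu) -> \bar R} :=
  (mu : set (caratheodory_type mu) -> \bar R).

Section cover_outer_measure.
Context (R : realType) (T : pointedType) (tau : set T -> \bar R).
Local Open Scope ereal_scope.

Definition cover_outer (A : set T) : \bar R :=
  ereal_inf [set \sum_(k <oo) tau (F k) |
             F in [set F : (set T)^nat | A `<=` \bigcup_k F k]].

Hypothesis tau0 : tau set0 = 0.
Hypothesis tau_ge0 : forall A, 0 <= tau A.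

Let cover_outerE :
  cover_outer = @mu_ext _ (g_sigma_algebraType [set: set T]) R tau.
Proof.
apply/funext => A; rewrite /cover_outer /mu_ext; congr (ereal_inf _).
apply/seteqP; split=> [_ [F AF <-]|_ [F [_ AF] <-]]; last by exists F.
by exists F => //; split => // i; exact: sub_sigma_algebra.
Qed.

Lemma cover_outer0 : cover_outer set0 = 0.
Proof. by rewrite cover_outerE mu_ext0. Qed.

Lemma cover_outer_ge0 A : 0 <= cover_outer A.
Proof. by rewrite cover_outerE mu_ext_ge0. Qed.

Lemma le_cover_outer : {homo cover_outer : A B / A `<=` B >-> A <= B}.
Proof. by rewrite cover_outerE => A B AB; exact: le_mu_ext. Qed.

Lemma cover_outer_sigma_subadditive : sigma_subadditive cover_outer.
Proof. by rewrite cover_outerE => F; exact: mu_ext_sigma_subadditive. Qed.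

End cover_outer_measure.

Section lebesgue_Rn.
Context (R : realType) (n : nat).
Local Open Scope ereal_scope.

Definition box (a b : 'rV[R]_n) : set 'rV[R]_n :=
  [set x | forall i, (a 0 i <= x 0 i <= b 0 i)%R].

(* the least volume of a box containing A, +oo if A is unbounded *)
Definition box_gauge (A : set 'rV[R]_n) : \bar R :=
  if `[< A = set0 >] then 0 else
  ereal_inf [set (\prod_(i < n) (ab.2 0 i - ab.1 0 i)%R)%:E |
             ab in [set ab : 'rV[R]_n * 'rV[R]_n | A `<=` box ab.1 ab.2]].

Lemma box_gauge0 : box_gauge set0 = 0.
Proof. by rewrite /box_gauge asboolT. Qed.

Lemma box_gauge_ge0 A : 0 <= box_gauge A.
Proof.
rewrite /box_gauge; case: asboolP => // /eqP/set0P[x Ax].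
apply: le_ereal_inf_tmp => _ [[a b] /= Aab <-].
rewrite lee_fin; apply: prodr_ge0 => i _; rewrite subr_ge0.
by have /andP[+ +] := Aab _ Ax i; exact: le_trans.
Qed.

Definition lebesgue_outer : set 'rV[R]_n -> \bar R := cover_outer box_gauge.

HB.instance Definition _ := isOuterMeasure.Build R 'rV[R]_n lebesgue_outer
  (cover_outer0 box_gauge0 box_gauge_ge0)
  (cover_outer_ge0 box_gauge_ge0)
  (@le_cover_outer _ _ box_gauge)
  (cover_outer_sigma_subadditive box_gauge_ge0).

Definition lebesgue_Rn : {measure set (caratheodory_type lebesgue_outer) -> \bar R} :=
  cara_measure lebesgue_outer.

End lebesgue_Rn.

Section hausdorff.
Context (R : realType) (n s : nat).
Local Open Scope ereal_scope.

Fixpoint unit_ball_volume (m : nat) : R :=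
  match m with
  | 0 => 1
  | 1 => 2
  | m'.+2 => 2 * pi / m%:R * unit_ball_volume m'
  end%R.

Lemma unit_ball_volume_ge0 m : (0 <= unit_ball_volume m)%R.
Proof.
suff: ((0 <= unit_ball_volume m) && (0 <= unit_ball_volume m.+1))%R by case/andP.
elim: m => [|m /andP[IH0 IH1]]; first by rewrite /= ler01 ler0n.
rewrite IH1/= mulr_ge0// mulr_ge0 ?invr_ge0 ?ler0n//.
by rewrite mulr_ge0 ?ler0n ?pi_ge0.
Qed.

Definition ediam (A : set 'rV[R]_n) : \bar R :=
  ereal_sup [set (enorm (x - y))%:E | x in A & y in A].

(* The factor unit_ball_volume s / 2 ^ s makes H^s agree with s-dimensional
   surface area. *)
Definition hausdorff_gauge (delta : R) (A : set 'rV[R]_n) : \bar R :=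
  if `[< A = set0 >] then 0 else
  if ediam A <= delta%:E
  then (unit_ball_volume s)%:E * (ediam A * (2^-1)%:E) ^+ s
  else +oo.

Lemma hausdorff_gauge0 delta : hausdorff_gauge delta set0 = 0.
Proof. by rewrite /hausdorff_gauge asboolT. Qed.

Lemma hausdorff_gauge_ge0 delta A : 0 <= hausdorff_gauge delta A.
Proof.
rewrite /hausdorff_gauge; case: asboolP => // /eqP/set0P[x Ax].
case: ifPn => // _; rewrite mule_ge0 ?lee_fin ?unit_ball_volume_ge0//.
apply: expe_ge0; apply: mule_ge0; last by rewrite lee_fin invr_ge0.
apply: (@le_trans _ _ (enorm (x - x))%:E); first by rewrite lee_fin sqrtr_ge0.
by apply: ereal_sup_ubound; exists x => //; exists x.
Qed.

Definition hausdorff_outer (A : set 'rV[R]_n) : \bar R :=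
  ereal_sup [set cover_outer (hausdorff_gauge delta) A |
             delta in [set delta : R | (0 < delta)%R]].

Let le_hausdorff delta A :
  (0 < delta)%R -> cover_outer (hausdorff_gauge delta) A <= hausdorff_outer A.
Proof. by move=> d0; apply: ereal_sup_ubound; exists delta. Qed.

Let hausdorff_ge0 A : 0 <= hausdorff_outer A.
Proof.
apply: le_trans (le_hausdorff A ltr01).
exact/cover_outer_ge0/hausdorff_gauge_ge0.
Qed.

Let hausdorff0 : hausdorff_outer set0 = 0.
Proof.
apply/eqP; rewrite eq_le hausdorff_ge0 andbT.
apply: ge_ereal_sup => _ [delta _ <-].
by rewrite cover_outer0//; [exact: hausdorff_gauge0|exact: hausdorff_gauge_ge0].
Qed.

Let hausdorff_le : {homo hausdorff_outer : A B / A `<=` B >-> A <= B}.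
Proof.
move=> A B AB; apply: ge_ereal_sup => _ [delta d0 <-].
by apply: le_trans (le_hausdorff B d0); exact: le_cover_outer.
Qed.

Let hausdorff_sigma_subadditive : sigma_subadditive hausdorff_outer.
Proof.
move=> F; apply: ge_ereal_sup => _ [delta d0 <-].
apply: le_trans (cover_outer_sigma_subadditive (hausdorff_gauge_ge0 delta) F) _.
apply: lee_nneseries => i *; last exact: le_hausdorff.
exact/cover_outer_ge0/hausdorff_gauge_ge0.
Qed.

HB.instance Definition _ := isOuterMeasure.Build R 'rV[R]_n hausdorff_outer
  hausdorff0 hausdorff_ge0 hausdorff_le hausdorff_sigma_subadditive.

Definition hausdorff : {measure set (caratheodory_type hausdorff_outer) -> \bar R} :=
  cara_measure hausdorff_outer.

End hausdorff.

Notation surface R d := (hausdorff R d.+1 d).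

Section complex_valued.
Context (R : realType).

Definition cintegral disp (T : measurableType disp)
    (mu : {measure set T -> \bar R}) (D : set T) (g : T -> R[i]) : R[i] :=
  (\int[mu]_(x in D) complex.Re (g x) +i* \int[mu]_(x in D) complex.Im (g x))%C.

Definition L2norm disp (T : measurableType disp)
    (mu : {measure set T -> \bar R}) (D : set T) (g : T -> R[i]) : \bar R :=
  'N[mu]_2%:E [(fun x => (Normc.normc (g x))%:E) \_ D].

Definition L2 disp (T : measurableType disp)
    (mu : {measure set T -> \bar R}) (D : set T) (g : T -> R[i]) : Prop :=
  [/\ measurable_fun D (fun x => complex.Re (g x)),
      measurable_fun D (fun x => complex.Im (g x)) &
      (L2norm mu D g < +oo)%E].

Definition expi (t : R) : R[i] := (cos t +i* sin t)%C.

Definition cderive n (g : 'rV[R]_n -> R[i]) (v x : 'rV[R]_n) : R[i] :=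
  ('D_v (fun y => complex.Re (g y)) x +i* 'D_v (fun y => complex.Im (g y)) x)%C.

End complex_valued.

Section green.
Context (R : realType).

Definition besselJ0 (t : R) : R :=
  limn (series (fun m => (-1) ^+ m / (m`!%:R ^+ 2) * (t / 2) ^+ m.*2)).

Definition euler_gamma : R := limn (fun m => series harmonic m - ln m%:R).

(* The standard expansion at 0; [series harmonic m] is the m-th harmonic
   number 1 + 1/2 + ... + 1/m.  Only used for 0 < t. *)
Definition besselY0 (t : R) : R :=
  2 / pi * ((ln (t / 2) + euler_gamma) * besselJ0 t
    - limn (series (fun m =>
        (-1) ^+ m * series harmonic m / (m`!%:R ^+ 2) * (t / 2) ^+ m.*2))).

Definition hankel0 (t : R) : R[i] := (besselJ0 t +i* besselY0 t)%C.

Definition sphericalJ0 (t : R) : R := if t == 0 then 1 else sin t / t.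

(* These are meant for n = 2 and n = 3; [Phi] has a junk value at x = y. *)
Definition Phi n (k : R) (x y : 'rV[R]_n) : R[i] :=
  let r := enorm (x - y) in
  if n == 2%N then (0 +i* 4^-1)%C * hankel0 (k * r)
  else expi (k * r) / (4 * pi * r)%:C%C.

Definition imPhi n (k : R) (x y : 'rV[R]_n) : R :=
  let r := enorm (x - y) in
  if n == 2%N then besselJ0 (k * r) / 4
  else k / (4 * pi) * sphericalJ0 (k * r).

Lemma enorm_eq0 n (v : 'rV[R]_n) : (enorm v == 0) = (v == 0).
Proof.
apply/idP/eqP => [|->]; last first.
  by rewrite /enorm big1 ?sqrtr0// => i _; rewrite mxE expr0n.
rewrite sqrtr_eq0 => v0; apply/rowP => i; rewrite mxE; apply/eqP.
rewrite -sqrf_eq0 eq_le sqr_ge0 andbT; apply: le_trans v0.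
by rewrite (bigD1 i)//= lerDl sumr_ge0// => j _; exact: sqr_ge0.
Qed.

Lemma Im_Phi n (k : R) (x y : 'rV[R]_n) : 0 < k -> x != y ->
  complex.Im (Phi k x y) = imPhi k x y.
Proof.
move=> k0 xy; rewrite /Phi /imPhi; set r := enorm _.
have r0 : r != 0 by rewrite enorm_eq0 subr_eq0.
case: ifPn => _ /=; first by rewrite mul0r add0r mulrC.
rewrite /sphericalJ0 mulf_eq0 gt_eqF//= (negbTE r0).
have p0 : pi != 0 :> R by rewrite gt_eqF// pi_gt0.
by rewrite expr0n/=; move: (@pi R) p0 => P P0; field; rewrite r0 P0 gt_eqF.
Qed.

End green.

Section lipschitz_domain.
Context (R : realType) (d : nat).
Implicit Types (Omega : set 'rV[R]_d.+1) (p v : 'rV[R]_d.+1).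

(* Near p, and in the coordinates y = x *m Q given by the orthogonal matrix Q,
   Omega is the part above the graph of phi. *)
Definition boundary_chart Omega p (r : R) (Q : 'M[R]_d.+1)
    (phi : 'rV[R]_d -> R) : Prop :=
  [/\ 0 < r, Q *m Q^T = 1%:M, lipschitz phi &
      forall x, eball p r x ->
        (Omega x <-> phi (col' ord_max (x *m Q)) < (x *m Q) 0 ord_max)].

Definition lipschitz_boundary Omega : Prop :=
  forall p, frontier Omega p -> exists r Q phi, boundary_chart Omega p r Q phi.

Definition bounded_lipschitz_domain Omega : Prop :=
  [/\ open Omega, connected Omega, Omega !=set0, bounded_set Omega &
      lipschitz_boundary Omega].

(* (grad phi (q), -1) *)
Definition graph_normal (phi : 'rV[R]_d -> R) (q : 'rV[R]_d) : 'rV[R]_d.+1 :=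
  \row_j (if unlift ord_max j is Some i then 'D_(delta_mx 0 i) phi q else -1).

Definition outward_normal_at Omega p v : Prop :=
  exists r Q phi, let q := col' ord_max (p *m Q) in
    [/\ boundary_chart Omega p r Q phi, differentiable phi q &
        v *m Q = (enorm (graph_normal phi q))^-1 *: graph_normal phi q].

(* By Rademacher's theorem the normal exists almost everywhere on the boundary;
   nu is any measurable representative of it. *)
Definition outward_unit_normal Omega (nu : 'rV[R]_d.+1 -> 'rV[R]_d.+1) : Prop :=
  (forall i, measurable_fun (frontier Omega : set (caratheodory_type _))
               (fun x : caratheodory_type (@hausdorff_outer R d.+1 d) => nu x 0 i)) /\
  {ae surface R d, forall x, frontier Omega x -> outward_normal_at Omega x (nu x)}.

End lipschitz_domain.

Section imaging.
Context (R : realType) (d : nat).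

(* f stands for its class in L^2: the support is the essential one. *)
Definition compact_support_in (Omega : set 'rV[R]_d.+1) (f : 'rV[R]_d.+1 -> R) :=
  exists K, [/\ compact K, K `<=` Omega &
    {ae lebesgue_Rn R d.+1, forall y, ~ K y -> f y = 0}].

Definition wave (Omega : set 'rV[R]_d.+1) (k : R) (f : 'rV[R]_d.+1 -> R)
    (x : 'rV[R]_d.+1) : R[i] :=
  cintegral (lebesgue_Rn R d.+1) Omega (fun y => Phi k x y * (f y)%:C%C).

(* The classical directional derivative: Im Phi is smooth, and the wave of a
   source with compact support in Omega is smooth near the boundary. *)
Definition normal_derivative (nu : 'rV[R]_d.+1 -> 'rV[R]_d.+1)
    (g : 'rV[R]_d.+1 -> R[i]) (x : 'rV[R]_d.+1) : R[i] :=
  cderive g (nu x) x.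

Definition imaging (Omega : set 'rV[R]_d.+1) (nu : 'rV[R]_d.+1 -> 'rV[R]_d.+1)
    (k : R) (g h : 'rV[R]_d.+1 -> R[i]) (z : 'rV[R]_d.+1) : R[i] :=
  let G x := (imPhi k x z)%:C%C in
  cintegral (surface R d) (frontier Omega)
    (fun x => normal_derivative nu G x * g x - G x * h x).

End imaging.

(* Main.v *)
Require Import Defs.
From HB Require Import structures.
From mathcomp Require Import all_boot all_order all_algebra.
From mathcomp Require Import all_classical all_reals all_analysis.
From mathcomp Require Import measurable_realfun complex.
From mathcomp Require Import ring lra.

(** The two imaging functions differ by
    [\int_F (a * (u - u_) - b * (du - du_))], where [F] is the boundary of [Omega],
    [b = Im Phi_k (., z)] and [a] is the normal derivative of [b].  If [|a| <= A]
    almost everywhere and [|b| <= B], with [A] and [B] independent of [z], and if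
    the surface measure of [F] is finite, then the [L^2] bounds on the noise give
    [L^1] bounds ([L1_of_L2norm]) and hence an error of order [delta]
    ([norm_Rintegral_pairing_sub_le]).

    The bounds on [a] and [b] come from an energy.  In both dimensions
    [Im Phi_k (x, z)] is a constant times [g (k ^+ 2 * |x - z| ^+ 2)], where [g] is
    an entire series with [4 * s * g'' + 2 * n * g' + g = 0] (the radial Helmholtz
    equation).  The energy [g ^+ 2 + 4 * s * g' ^+ 2] decreases along this equation
    from its value [1] at the origin ([helmholtz_energy_le1]), which bounds
    [Im Phi_k] and its gradient on the whole space ([norm_imPhi_le],
    [norm_derive_imPhi_le]).

    The surface measure is finite because the compact boundary is covered by
    finitely many graphs of Lipschitz functions, and a Lipschitz image of a cube of
    dimension [d] has finite [d]-dimensional Hausdorff measure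
    ([hausdorff_lipschitz_image], [hausdorff_frontier_finite]).

    Linearity of the integral requires the data to be measurable and integrable.
    Continuous functions are measurable for the Lebesgue and the Hausdorff measure
    once half-spaces are ([lebesgue_half_space], [hausdorff_half_space]); for the
    latter this is the criterion of Caratheodory for metric outer measures.  Away
    from the compact set [K] that carries the source, the wave is a volume potential
    with a kernel that is continuously differentiable off the diagonal.  It is
    therefore continuous there and has all directional derivatives
    ([continuous_potential], [derivable_potential]), and its normal derivative is
    measurable as a limit of difference quotients
    ([measurable_directional_derivative]).  The exact data are then integrable
    because the noisy data and the noise are. *)

Set Implicit Arguments.
Unset Strict Implicit.
Unset Printing Implicit Defensive.

Import Order.TTheory GRing.Theory Num.Theory.
Import numFieldNormedType.Exports.

Local Open Scope classical_set_scope.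
Local Open Scope ring_scope.

(** * Half-spaces are Caratheodory measurable *)

Section cover_outer_split.
Context (R : realType) (T : pointedType) (tau : set T -> \bar R).
Local Open Scope ereal_scope.
Hypothesis tau_ge0 : forall A, 0 <= tau A.

(** Every cover of [X] restricts to a cover of [A] by subsets of [P] and to a cover
    of [B] by subsets of [Q]. *)
Lemma le_cover_outer_split (P Q A B X : set T) :
  (forall F, tau (F `&` P) + tau (F `&` Q) <= tau F) ->
  A `<=` X `&` P -> B `<=` X `&` Q ->
  cover_outer tau A + cover_outer tau B <= cover_outer tau X.
Proof.
move=> split_tau AX BX; apply: le_ereal_inf_tmp => _ [F /= XF <-].
apply: (@le_trans _ _ (\sum_(k <oo) tau (F k `&` P) +
                       \sum_(k <oo) tau (F k `&` Q))).
  apply: leeD; apply: ge_ereal_inf.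
    exists (\sum_(k <oo) tau (F k `&` P)) => //; exists (fun k => F k `&` P) => //=.
    by rewrite -setI_bigcupl => x /AX[Xx Px]; split=> //; exact: XF.
  exists (\sum_(k <oo) tau (F k `&` Q)) => //; exists (fun k => F k `&` Q) => //=.
  by rewrite -setI_bigcupl => x /BX[Xx Qx]; split=> //; exact: XF.
by rewrite -nneseriesD//; apply: lee_nneseries => k _; rewrite ?adde_ge0.
Qed.

End cover_outer_split.

Section caratheodory_criterion.
Context (R : realType) (T : pointedType) (mu : {outer_measure set T -> \bar R}).
Variable g : T -> R.
Local Open Scope ereal_scope.
Hypothesis mu_separated : forall (a b : R) (A B : set T), (a < b)%R ->
  A `<=` [set x | (g x <= a)%R] -> B `<=` [set x | (b <= g x)%R] ->
  mu A + mu B <= mu (A `|` B).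

(** Only every other strip between consecutive values of [s] is used, so the layers
    are separated from each other and their measures add up. *)
Lemma le_sum_outer_layers (s : nat -> R) (U : nat -> set T) (X : set T) (n : nat) :
  (forall i, s i.+1 < s i)%R ->
  (forall i, U i `<=` X `&` [set x | (s i.*2.+1 <= g x <= s i.*2)%R]) ->
  \sum_(i < n) mu (U i) <= mu X.
Proof.
move=> sdec UX.
suff [H1 _] : \sum_(i < n) mu (U i) <= mu (\big[setU/set0]_(i < n) U i) /\
    (\big[setU/set0]_(i < n) U i `<=` [set x | (s n.*2.-1 <= g x)%R]).
  apply: le_trans H1 _; apply: le_outer_measure.
  by rewrite -bigcup_mkord => x [i _ Ux]; exact: (UX i x Ux).1.
elim: n => [|n [IH1 IH2]]; first by rewrite !big_ord0 outer_measure0; split=> [|x []].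
rewrite !big_ord_recr /=; split; last first.
  move=> x [/IH2/=|/UX[_ /andP[+ _]]//]; apply: le_trans.
  case: n {IH1 IH2} => [|n] /=; first exact: ltW.
  by rewrite ltW// (lt_trans (sdec _) (sdec _)).
apply: le_trans (leeD2r _ IH1) _; case: n IH2 {IH1} => [_|n IH2].
  by rewrite !big_ord0 outer_measure0 add0e set0U.
rewrite addeC setUC; apply: (mu_separated (sdec n.*2.+1)) => //.
by move=> x /UX[_ /andP[_ +]]; rewrite doubleS.
Qed.

(** Only the part of [X] where [g] is slightly above [c] is not separated from the
    part where [g <= c].  That part is a union of layers [t j.+1 < g <= t j]; the
    layers with [j] even are separated from each other, and so are those with [j]
    odd, so the measures of all layers have a finite sum, whose tails vanish. *)
Lemma caratheodory_criterion (c : R) : mu.-caratheodory [set x | (g x <= c)%R].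
Proof.
apply: le_caratheodory_measurable => X.
have [->|Xoo] := eqVneq (mu X) +oo; first exact: leey.
pose t (j : nat) : R := (c + j.+1%:R^-1)%R.
have tlt j : (t j.+1 < t j)%R by rewrite /t ltrD2l ltf_pV2 ?posrE ?ltr_nat.
pose T_ j := X `&` [set x | (t j.+1 < g x <= t j)%R].
have Tsum : \sum_(j <oo) mu (T_ j) < +oo.
  apply: (@le_lt_trans _ _ (mu X + mu X)); last by rewrite lte_add_pinfty ?ltey.
  apply: lime_le; first by apply: is_cvg_nneseries => *; exact: outer_measure_ge0.
  apply: nearW => n; rewrite /= big_mkord.
  apply: (@le_trans _ _ (\sum_(j < n) (mu (T_ j.*2) + mu (T_ j.*2.+1)))).
    rewrite -(big_mkord xpredT (fun j => mu (T_ j))).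
    rewrite -(big_mkord xpredT (fun j => mu (T_ j.*2) + mu (T_ j.*2.+1))).
    apply: (@le_trans _ _ (\sum_(0 <= j < n.*2) mu (T_ j))).
      apply: lee_sum_nneg_natr => [? _ _|]; first exact: outer_measure_ge0.
      by rewrite -addnn leq_addr.
    elim: n => [|n IH]; first by rewrite !big_geq.
    by rewrite doubleS !big_nat_recr//= addeA leeD2r// leeD2r.
  rewrite big_split leeD//.
    apply: (@le_sum_outer_layers t (fun i => T_ i.*2)) => // i x [Xx /andP[tx xt]]; split=> //=.
    by rewrite xt ltW.
  apply: (@le_sum_outer_layers (t \o succn) (fun i => T_ i.*2.+1)).
    by move=> i; exact: tlt.
  move=> i x [Xx /andP[tx xt]].
  by split=> //=; rewrite xt ltW.
apply/lee_addgt0Pr => e e0.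
have /fine_cvgP[_] := nneseries_tail_cvg Tsum (fun j _ => outer_measure_ge0 mu _).
have T0 k : 0 <= \sum_(k <= j <oo) mu (T_ j).
  by apply: nneseries_ge0 => *; exact: outer_measure_ge0.
have Tfin k : \sum_(k <= j <oo) mu (T_ j) \is a fin_num.
  rewrite ge0_fin_numE//; apply: le_lt_trans Tsum.
  rewrite [leRHS](nneseries_split _ k)//.
  by rewrite add0n leeDr// sume_ge0.
move/cvgrPdist_le => /(_ _ e0)[k _ /(_ k (leqnn k))/=].
rewrite sub0r normrN ger0_norm ?fine_ge0// => tailk.
have {}tailk : \sum_(k <= j <oo) mu (T_ j) <= e%:E.
  by rewrite -(fineK (Tfin k)) lee_fin.
pose S := X `&` [set x | (t k < g x)%R].
apply: (@le_trans _ _ (mu (X `&` [set x | (g x <= c)%R]) + (mu S + e%:E))).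
  apply: leeD2l; apply: (@le_trans _ _ (mu (S `|` \bigcup_(j in ~` `I_k) T_ j))).
    apply: le_outer_measure => x [Xx /negP]; rewrite -ltNge => cx.
    have [tx|xt] := ltP (t k) (g x); [by left|right].
    have gc0 : (0 < g x - c)%R by rewrite subr_gt0.
    have [m0 _ /(_ (k + m0)%N (leq_addl _ _))/= m0P] :=
      near_infty_natSinv_lt (PosNum gc0).
    have ex_m : exists m, (t (k + m)%N < g x)%R.
      by exists m0; rewrite /t addrC -ltrBrDr.
    case: (ex_minnP ex_m) => -[|m] tm minm; first by rewrite ltNge addn0 xt in tm.
    exists (k + m)%N; first by move=> /=; rewrite ltnNge leq_addr.
    split=> //=; rewrite -addnS tm leNgt; apply/negP => /minm.
    by rewrite ltnn.
  apply: le_trans (outer_measureU2 _ _ _) _; apply: leeD2l.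
  apply: le_trans tailk; exact: outer_measure_sigma_subadditive_tail.
rewrite addeA; apply: leeD2r.
apply: (@le_trans _ _ (mu ((X `&` [set x | (g x <= c)%R]) `|` S))).
  apply: (@mu_separated c (t k)); first by rewrite /t ltrDl invr_gt0.
  - by move=> x [].
  - by move=> x [_ /ltW].
by apply: le_outer_measure => x [[]|[]].
Qed.

End caratheodory_criterion.
Section half_spaces.
Context (R : realType) (n : nat).
Local Open Scope ereal_scope.

Lemma le_box_gauge (A B : set 'rV[R]_n) : A `<=` B -> box_gauge A <= box_gauge B.
Proof.
move=> AB; rewrite /box_gauge; case: asboolP => [|A0].
  by move=> _; exact: box_gauge_ge0.
case: asboolP => [B0|_].
  by exfalso; apply: A0; apply/seteqP; split=> // x /AB; rewrite B0.
apply: le_ereal_inf => _ [ab /= Bab <-]; exists ab => //=.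
exact: subset_trans Bab.
Qed.

(** A hyperplane orthogonal to an axis cuts a box into two boxes whose volumes
    add up to that of the box. *)
Lemma box_gauge_split (i : 'I_n) (c : R) (F : set 'rV[R]_n) :
  box_gauge (F `&` [set x : 'rV[R]_n | (x 0 i <= c)%R]) +
  box_gauge (F `&` ~` [set x : 'rV[R]_n | (x 0 i <= c)%R]) <= box_gauge F.
Proof.
set P := [set x | _].
have [/eqP ->|/set0P[x [Fx xc]]] := boolP (F `&` P == set0).
  by rewrite box_gauge0 add0e; exact: le_box_gauge.
have [/eqP ->|/set0P[y [Fy /negP]]] := boolP (F `&` ~` P == set0).
  by rewrite box_gauge0 adde0; exact: le_box_gauge.
rewrite -ltNge => cy.
rewrite [leRHS]/box_gauge asboolF; last by move=> F0; rewrite F0 in Fx.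
apply: le_ereal_inf_tmp => _ [[a b] /= Fab <-].
have ai_le : (a 0 i <= c)%R by have /andP[+ _] := Fab _ Fx i; move/le_trans; exact.
have le_bi : (c <= b 0 i)%R.
  by have /andP[_ +] := Fab _ Fy i; apply: le_trans; exact: ltW.
pose b' : 'rV[R]_n := \row_j (if j == i then c else b 0 j)%R.
pose a' : 'rV[R]_n := \row_j (if j == i then c else a 0 j)%R.
have gauge_le (G : set 'rV[R]_n) (p q : 'rV[R]_n) z : G z -> G `<=` box p q ->
    box_gauge G <= (\prod_(j < n) (q 0 j - p 0 j)%R)%:E.
  move=> Gz Gpq; rewrite /box_gauge asboolF; last by move=> G0; rewrite G0 in Gz.
  by apply: ge_ereal_inf; exists (\prod_(j < n) (q 0 j - p 0 j)%R)%:E => //; exists (p, q).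
apply: (@le_trans _ _ ((\prod_(j < n) (b' 0 j - a 0 j)%R)%:E +
                       (\prod_(j < n) (b 0 j - a' 0 j)%R)%:E)).
  apply: leeD.
    apply: (gauge_le _ _ _ x) => // z [Fz zc] j; have /andP[zl zr] := Fab _ Fz j.
    by rewrite zl mxE; case: eqP => // ->.
  apply: (gauge_le _ _ _ y); first by split=> //; apply/negP; rewrite -ltNge.
  move=> z [Fz /negP]; rewrite -ltNge => zc j; have /andP[zl zr] := Fab _ Fz j.
  by rewrite zr mxE andbT; case: eqP => // ->; exact: ltW.
rewrite -EFinD lee_fin (bigD1 i)//= [X in (_ + X)%R](bigD1 i)//= [leRHS](bigD1 i)//=.
rewrite !mxE eqxx.
rewrite (eq_bigr (fun j => b 0 j - a 0 j)%R); last first.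
  by move=> j ji; rewrite mxE (negbTE ji).
rewrite [X in (_ + _ * X)%R](eq_bigr (fun j => b 0 j - a 0 j)%R); last first.
  by move=> j ji; rewrite mxE (negbTE ji).
by rewrite -mulrDl addrC addrA subrK.
Qed.

Lemma lebesgue_half_space (i : 'I_n) (c : R) :
  (@lebesgue_outer R n).-caratheodory [set x : 'rV[R]_n | (x 0 i <= c)%R].
Proof.
apply: le_caratheodory_measurable => X.
by apply: le_cover_outer_split (box_gauge_split i c) _ _ => //; exact: box_gauge_ge0.
Qed.

Variable s : nat.

Lemma le_expe (x y : \bar R) m : 0 <= x -> x <= y -> x ^+ m <= y ^+ m.
Proof.
move=> x0 xy; elim: m => [|m IH]; first by rewrite !expe0.
by rewrite !expeS lee_pmul// expe_ge0.
Qed.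

Lemma le_ediam (A B : set 'rV[R]_n) : A `<=` B -> ediam A <= ediam B.
Proof.
move=> AB; apply: ge_ereal_sup => _ [x Ax [y Ay <-]].
by apply: ereal_sup_ubound; exists x; [exact: AB|exists y; [exact: AB|]].
Qed.

Lemma ediam_ge0 (A : set 'rV[R]_n) : A !=set0 -> 0 <= ediam A.
Proof.
move=> [x Ax]; apply: (@le_trans _ _ (enorm (x - x))%:E).
  by rewrite lee_fin sqrtr_ge0.
by apply: ereal_sup_ubound; exists x => //; exists x.
Qed.

Lemma le_hausdorff_gauge (delta : R) (A B : set 'rV[R]_n) : A `<=` B ->
  hausdorff_gauge s delta A <= hausdorff_gauge s delta B.
Proof.
move=> AB; rewrite {1}/hausdorff_gauge; case: asboolP => [|/eqP/set0P A0].
  by move=> _; exact: hausdorff_gauge_ge0.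
rewrite /hausdorff_gauge asboolF; last first.
  by move=> B0; have [x /AB] := A0; rewrite B0.
have [dB|_] := leP (ediam B) delta%:E; last by rewrite leey.
rewrite (le_trans (le_ediam AB) dB).
apply: lee_wpmul2l; first by rewrite lee_fin unit_ball_volume_ge0.
have half0 : 0 <= (2^-1)%:E :> \bar R by rewrite lee_fin invr_ge0.
apply: le_expe; first by rewrite mule_ge0 ?ediam_ge0.
by rewrite lee_wpmul2r// le_ediam.
Qed.

Lemma le_abs_coord_enorm (v : 'rV[R]_n) (i : 'I_n) : (`|v 0 i| <= enorm v)%R.
Proof.
rewrite -sqrtr_sqr ler_sqrt ?sqr_ge0//; last by apply: sumr_ge0 => *; exact: sqr_ge0.
by rewrite (bigD1 i)//= lerDl sumr_ge0// => *; exact: sqr_ge0.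
Qed.

(** A set that meets both half-spaces has diameter at least [b - a], so it has
    infinite gauge as soon as [delta < b - a]. *)
Lemma hausdorff_separated (i : 'I_n) (a b : R) (A B : set 'rV[R]_n) : (a < b)%R ->
  A `<=` [set x : 'rV[R]_n | (x 0 i <= a)%R] -> B `<=` [set x : 'rV[R]_n | (b <= x 0 i)%R] ->
  hausdorff_outer s A + hausdorff_outer s B <= hausdorff_outer s (A `|` B).
Proof.
move=> ab Aa Bb.
have cover_le (delta' delta : R) (X : set 'rV[R]_n) : (0 < delta <= delta')%R ->
    cover_outer (hausdorff_gauge s delta') X <= cover_outer (hausdorff_gauge s delta) X.
  move=> /andP[_ dd]; apply: le_ereal_inf_tmp => _ [F /= XF <-].
  apply: (@le_trans _ _ (\sum_(k <oo) hausdorff_gauge s delta' (F k))).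
    by apply: ge_ereal_inf; exists (\sum_(k <oo) hausdorff_gauge s delta' (F k)) => //; exists F.
  apply: lee_nneseries => [k _ _|k _]; first exact: hausdorff_gauge_ge0.
  rewrite /hausdorff_gauge; case: asboolP => // _.
  have [Fd|] := leP (ediam (F k)) delta%:E; last by rewrite leey.
  by rewrite (le_trans Fd) ?lee_fin.
have key (d1 d2 : R) : (0 < d1)%R -> (0 < d2)%R ->
    cover_outer (hausdorff_gauge s d1) A + cover_outer (hausdorff_gauge s d2) B
    <= hausdorff_outer s (A `|` B).
  (* a common scale, small enough that no set of finite gauge meets both sides *)
  move=> d10 d20; pose d := Num.min (Num.min d1 d2) ((b - a) / 2)%R.
  have d0 : (0 < d)%R by rewrite !lt_min d10 d20 divr_gt0 ?subr_gt0.
  have dba : (d < b - a)%R.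
    by rewrite gt_min ltr_pdivrMr ?ltr_pMr ?subr_gt0// ltr1n orbT.
  apply: (@le_trans _ _ (cover_outer (hausdorff_gauge s d) (A `|` B))); last first.
    by apply: ereal_sup_ubound; exists d.
  apply: (@le_trans _ _ (cover_outer (hausdorff_gauge s d) A +
                         cover_outer (hausdorff_gauge s d) B)).
    by apply: leeD; apply: cover_le; rewrite d0 /= !ge_min lexx ?orbT.
  apply: (@le_cover_outer_split _ _ _ _ [set x : 'rV[R]_n | (x 0 i <= a)%R] [set x : 'rV[R]_n | (b <= x 0 i)%R]).
  - exact: hausdorff_gauge_ge0.
  - move=> F; have [/eqP ->|/set0P[x [Fx xa]]] := boolP (F `&` [set x : 'rV[R]_n | (x 0 i <= a)%R] == set0).
      by rewrite hausdorff_gauge0 add0e; exact: le_hausdorff_gauge.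
    have [/eqP ->|/set0P[y [Fy yb]]] := boolP (F `&` [set x : 'rV[R]_n | (b <= x 0 i)%R] == set0).
      by rewrite hausdorff_gauge0 adde0; exact: le_hausdorff_gauge.
    rewrite [leRHS]/hausdorff_gauge asboolF; last by move=> F0; rewrite F0 in Fx.
    rewrite ifF ?leey//; apply/negbTE; rewrite -ltNge.
    apply: (@lt_le_trans _ _ (enorm (y - x))%:E); last first.
      by apply: ereal_sup_ubound; exists y => //; exists x.
    rewrite lte_fin (lt_le_trans dba)//.
    apply: le_trans (le_abs_coord_enorm _ i); rewrite !mxE.
    by apply: le_trans (ler_norm _); rewrite lerB.
  - by move=> x Ax; split; [left|exact: Aa].
  - by move=> x Bx; split; [right|exact: Bb].
have [->|Xoo] := eqVneq (hausdorff_outer s (A `|` B)) +oo; first exact: leey.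
have fin_sub Y : Y `<=` A `|` B -> hausdorff_outer s Y \is a fin_num.
  move=> YX; rewrite ge0_fin_numE ?outer_measure_ge0//.
  by rewrite (le_lt_trans (le_outer_measure _ _ _ YX))// ltey.
have cover_fin Y delta : (0 < delta)%R -> Y `<=` A `|` B ->
    cover_outer (hausdorff_gauge s delta) Y \is a fin_num.
  move=> d0 YX; rewrite ge0_fin_numE; last exact/cover_outer_ge0/hausdorff_gauge_ge0.
  apply: (@le_lt_trans _ _ (hausdorff_outer s Y)).
    by apply: ereal_sup_ubound; exists delta.
  by rewrite -ge0_fin_numE ?fin_sub// outer_measure_ge0.
rewrite -leeBrDr ?fin_sub//; apply: ge_ereal_sup => _ [d1 d10 <-].
rewrite leeBrDr ?fin_sub// addeC -leeBrDr ?cover_fin//.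
apply: ge_ereal_sup => _ [d2 d20 <-].
by rewrite leeBrDr ?cover_fin// addeC; exact: key.
Qed.

Lemma hausdorff_half_space (i : 'I_n) (c : R) :
  (@hausdorff_outer R n s).-caratheodory [set x : 'rV[R]_n | (x 0 i <= c)%R].
Proof.
exact: (caratheodory_criterion (hausdorff_separated (i := i))).
Qed.

End half_spaces.
(** * Measurability of continuous functions and of directional derivatives *)

Section open_preimages.
Context (R : realType) (n : nat).
Implicit Types (x y : 'rV[R]_n).

Lemma le_abs_coord_norm x i : `|x 0 i| <= `|x|.
Proof.
rewrite [leRHS]mx_normrE; exact: (le_bigmax _ (fun ij : 'I_1 * 'I_n => `|x ij.1 ij.2|) (0, i)).
Qed.

Lemma le_norm_coord x (e : R) : 0 <= e -> (forall i, `|x 0 i| <= e) -> `|x| <= e.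
Proof.
move=> e0 xe; rewrite [leLHS]mx_normrE; apply: bigmax_le => // -[i j] _ /=.
by rewrite ord1.
Qed.

Definition rat_cube (p : 'rV[rat]_n * rat) : set 'rV[R]_n :=
  [set x | forall i, `|x 0 i - ratr (p.1 0 i)| < ratr p.2].

(** Countability of the rational cubes reduces the measurability of preimages of
    open sets to that of the coordinates. *)
Lemma open_bigcup_rat_cube (V : set 'rV[R]_n) : open V ->
  V = \bigcup_p (if `[< rat_cube p `<=` V >] then rat_cube p else set0).
Proof.
move=> oV; apply/seteqP; split=> [x Vx|x [p _]]; last first.
  by case: asboolP => // + xp; exact.
have /nbhs_normP[e /= e0 eV] := open_nbhs_nbhs (conj oV Vx).
have e40 : 0 < e / 4 by rewrite divr_gt0.
have [q] := rat_in_itvoo e40.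
rewrite in_itv/= => /andP[q0 qe].
have /choice[c cP] : forall i : 'I_n, exists c : rat, `|x 0 i - ratr c| < ratr q.
  move=> i; have [|c] := @rat_in_itvoo R (x 0 i - ratr q) (x 0 i + ratr q).
    by rewrite ltrBlDr -addrA ltrDl addr_gt0.
  rewrite in_itv/= => /andP[c1 c2]; exists c.
  by rewrite distrC ltr_distl c1 c2.
exists (\row_i c i, q) => //=; rewrite asboolT /=; first by move=> i; rewrite mxE.
move=> y yp; apply: eV => /=; apply: (@le_lt_trans _ _ (e / 2)); last first.
  by rewrite ltr_pdivrMr// ltr_pMr// ltr1n.
apply: le_norm_coord => [|i]; first by rewrite divr_ge0// ltW.
have := yp i; rewrite /= mxE => ypi.
rewrite !mxE -(subrKA (ratr (c i))) (le_trans (ler_normD _ _))//.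
have := cP i; rewrite (distrC (ratr (c i))); move: ypi qe; lra.
Qed.

Context d (T : measurableType d).

Lemma measurable_preimage_open (D : set T) (X : T -> 'rV[R]_n) (V : set 'rV[R]_n) :
  measurable D -> (forall i, measurable_fun D (fun t => X t 0 i)) -> open V ->
  measurable (D `&` X @^-1` V).
Proof.
move=> mD mX /open_bigcup_rat_cube ->.
rewrite preimage_bigcup setI_bigcupr.
apply: countable_bigcupT_measurable => [|p]; first exact: countableP.
case: asboolP => _; last by rewrite preimage_set0 setI0; exact: measurable0.
have -> : D `&` X @^-1` rat_cube p =
    D `&` \bigcap_(i in [set: 'I_n])
      (D `&` (fun t => X t 0 i) @^-1` [set r | `|r - ratr (p.1 0 i)| < ratr p.2]).
  apply/seteqP; split=> [t [Dt tp]|t [Dt tp]].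
    by split=> // i _; split=> //; exact: tp.
  by split=> // i; have [] := tp i Logic.I.
apply: measurableI => //; apply: fin_bigcap_measurable => // i _.
apply: mX => //.
have -> : [set r : R | `|r - ratr (p.1 0 i)| < ratr p.2] =
    ball (ratr (p.1 0 i) : R) (ratr p.2).
  by rewrite -ball_normE; apply/seteqP; split => r /=; rewrite distrC.
exact: measurable_ball.
Qed.

(** A function continuous on an open set can be composed with a measurable map
    as long as the values outside of that set are replaced by a constant. *)
Lemma measurable_comp_continuous (D : set T) (X : T -> 'rV[R]_n)
    (V : set 'rV[R]_n) (w : 'rV[R]_n -> R) :
  measurable D -> (forall i, measurable_fun D (fun t => X t 0 i)) -> open V ->
  (forall x, V x -> {for x, continuous w}) ->
  measurable_fun D (fun t => if X t \in V then w (X t) else 0).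
Proof.
move=> mD mX oV cw.
have DV : D `&` (fun t => X t \in V) @^-1` [set true] = D `&` X @^-1` V.
  apply/seteqP; split=> t [Dt Vt]; first by split=> //; exact: set_mem.
  by split=> //; exact: mem_set.
apply: measurable_fun_if => //.
- apply: (measurable_fun_bool true) => //.
  by rewrite DV; exact: measurable_preimage_open.
- rewrite DV.
  apply: (measurability _ (RGenOInfty.measurableE R)) => // _ [_ [a ->] <-].
  pose U : set R := `]a, +oo[%classic.
  have oU : open U by exact: interval_open.
  have -> : D `&` X @^-1` V `&` (fun t => w (X t)) @^-1` U =
      D `&` X @^-1` (V `&` w @^-1` U).
    by rewrite preimage_setI setIA.
  apply: measurable_preimage_open => //.
  rewrite openE => x [Vx Ux]; apply: filterI.
    exact: open_nbhs_nbhs.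
  exact: (cw x Vx _ (open_nbhs_nbhs (conj oU Ux))).
Qed.

End open_preimages.
Section measurable_derivative.
Context (R : realType) (n : nat) d (T : measurableType d).

(** A directional derivative that exists is the limit of the difference
    quotients along [m.+1%:R^-1]; the quotients are replaced by [0] while the
    perturbed point has not yet entered the domain of continuity. *)
Lemma measurable_directional_derivative (D : set T) (X v : T -> 'rV[R]_n)
    (V : set 'rV[R]_n) (w : 'rV[R]_n -> R) :
  measurable D ->
  (forall i, measurable_fun D (fun t => X t 0 i)) ->
  (forall i, measurable_fun D (fun t => v t 0 i)) ->
  open V -> (forall t, D t -> V (X t)) ->
  (forall x, V x -> {for x, continuous w}) ->
  (forall t, D t -> derivable w (X t) (v t)) ->
  measurable_fun D (fun t => 'D_(v t) w (X t)).
Proof.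
move=> mD mX mv oV DV cw dw.
pose Y m t := m.+1%:R^-1 *: v t + X t.
pose ext (Z : T -> 'rV[R]_n) t := if Z t \in V then w (Z t) else 0.
have mext (Z : T -> 'rV[R]_n) :
    (forall i, measurable_fun D (fun t => Z t 0 i)) -> measurable_fun D (ext Z).
  by move=> mZ; exact: measurable_comp_continuous.
apply: (@measurable_fun_cvg _ _ _ _
  (fun m t => m.+1%:R * (ext (Y m) t - ext X t))).
  move=> m; apply: measurable_funM => //; apply: measurable_funB; last exact: mext.
  apply: mext => i; apply: (eq_measurable_fun (fun t => m.+1%:R^-1 * v t 0 i + X t 0 i)).
    by move=> t _; rewrite !mxE.
  by apply: measurable_funD => //; exact: measurable_funM.
move=> t Dt; have /cvgr_dnbhsP/(_ harmonic) := dw t Dt.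
have h0 : (forall m, harmonic m != 0 :> R) /\ @harmonic R @ \oo --> 0.
  by split=> [m|]; [rewrite gt_eqF// harmonic_gt0|exact: cvg_harmonic].
move=> /(_ h0); apply: cvg_trans; apply: near_eq_cvg.
have cY : Y m t @[m --> \oo] --> X t.
  rewrite -[X in _ --> X]add0r; apply: cvgD; last exact: cvg_cst.
  rewrite -[X in _ --> X](scale0r (v t)); apply: cvgZr_tmp; exact: cvg_harmonic.
have : \forall m \near \oo, V (Y m t).
  by apply: cY; apply: open_nbhs_nbhs; split=> //; exact: DV.
apply: filterS => m Vm; rewrite /ext (mem_set Vm) (mem_set (DV _ Dt)).
by rewrite /= invrK.
Qed.

End measurable_derivative.

(** * Surface measure of a Lipschitz boundary *)

Section lipschitz_image.
Context (R : realType) (d n : nat).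

Lemma grid_interval (N : nat) (t : R) : 0 <= t <= N.+1%:R ->
  exists j : 'I_N.+1, j%:R <= t <= j.+1%:R.
Proof.
elim: N => [|N IH] /andP[t0 tN]; first by exists ord0; rewrite t0 tN.
have [tN'|Nt] := leP t N.+1%:R; last by exists ord_max; rewrite /= tN ltW.
have [|j jt] := IH; first by rewrite t0 tN'.
by exists (widen_ord (leqnSn _) j).
Qed.

Definition cube (M : R) : set 'rV[R]_d := [set q | forall i, `|q 0 i| <= M].

(** Cutting the cube into [N ^ d] cubes of side [2 * M / N], whose images have
    diameter at most [2 * L * M / N], bounds the sum of the gauges independently
    of [N]. *)
Lemma hausdorff_lipschitz_image (G : 'rV[R]_d -> 'rV[R]_n) (L M : R) :
  0 <= L -> 0 < M ->
  (forall q q', cube M q -> cube M q' -> enorm (G q - G q') <= L * `|q - q'|) ->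
  (hausdorff_outer d (G @` cube M) <= (unit_ball_volume R d * (L * M) ^+ d)%:E)%E.
Proof.
move=> L0 M0 lipG; apply: ge_ereal_sup => _ [delta /= delta0 <-].
have [N HN] : exists N, L * (2 * M / N.+1%:R) <= delta.
  have e0 : 0 < delta / (L * (2 * M) + 1).
    by rewrite divr_gt0// ltr_wpDl// mulr_ge0// mulr_ge0// ltW.
  have [N _ /(_ N (leqnn N))/= HN] := near_infty_natSinv_lt (PosNum e0).
  exists N; rewrite mulrA; apply: le_trans (_ : (L * (2 * M) + 1) * N.+1%:R^-1 <= _).
    by rewrite ler_wpM2r// lerDl.
  rewrite mulrC -ler_pdivlMr; first exact: ltW.
  by rewrite ltr_wpDl// mulr_ge0// mulr_ge0// ltW.
pose h := 2 * M / N.+1%:R.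
have h0 : 0 < h by rewrite divr_gt0// mulr_gt0.
pose I := {ffun 'I_d -> 'I_N.+1}.
pose Q (c : I) : set 'rV[R]_d :=
  [set q | cube M q /\ forall i, (c i)%:R * h <= q 0 i + M <= (c i).+1%:R * h].
pose F k := nth set0 [seq G @` Q c | c : I] k.
have size_F : size [seq G @` Q c | c : I] = #|I| by rewrite size_map -cardE.
apply: (@le_trans _ _ (\sum_(k <oo) hausdorff_gauge d delta (F k))%E).
  apply: ge_ereal_inf; exists (\sum_(k <oo) hausdorff_gauge d delta (F k))%E => //.
  exists F => //= _ [q Mq <-].
  have /choice[c cP] : forall i : 'I_d, exists j : 'I_N.+1,
      j%:R * h <= q 0 i + M <= j.+1%:R * h.
    move=> i; have := Mq i; rewrite ler_norml => /andP[q1 q2].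
    have [|j] := @grid_interval N ((q 0 i + M) / h).
      rewrite divr_ge0 ?(ltW h0)//=; last by rewrite -lerBlDr sub0r.
      rewrite ler_pdivrMr// /h mulrC divfK ?pnatr_eq0//.
      by rewrite mulr2n mulrDl mul1r lerD2r.
    by rewrite ler_pdivlMr// ler_pdivrMr// => ?; exists j.
  exists (enum_rank [ffun i => c i]) => //.
  rewrite /F (nth_map [ffun i => c i]) -?cardE// nth_enum_rank.
  by exists q => //; split=> // i; rewrite ffunE.
rewrite (nneseries_split 0%N #|I|); last by move=> k _; exact: hausdorff_gauge_ge0.
rewrite [X in (_ + X)%E]eseries0 ?adde0; last first.
  by move=> k; rewrite add0n => kI _; rewrite /F nth_default ?size_F// hausdorff_gauge0.
pose b : R := unit_ball_volume R d * (L * h / 2) ^+ d.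
apply: (@le_trans _ _ (\sum_(0 <= k < 0 + #|I|) b%:E)%E); last first.
  rewrite sumEFin lee_fin add0n sumr_const_nat subn0 card_ffun !card_ord.
  rewrite -[b *+ _]mulr_natr natrX /b -mulrA -exprMn.
  have hN : h * N.+1%:R = 2 * M by rewrite divfK// pnatr_eq0.
  by rewrite (_ : L * h / 2 * N.+1%:R = L * M)// mulrAC -(mulrA L) hN; field.
apply: lee_sum => k _; rewrite /hausdorff_gauge; case: asboolP => [_|/eqP/set0P F0].
  rewrite lee_fin mulr_ge0 ?unit_ball_volume_ge0// exprn_ge0//.
  by rewrite divr_ge0// mulr_ge0// ltW.
have [kI|Ik] := ltnP k #|I|; last first.
  by move: F0; rewrite /F nth_default ?size_F// => -[].
have diamF : (ediam (F k) <= (L * h)%:E)%E.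
  apply: ge_ereal_sup => _ [x Fx [y Fy <-]]; move: Fx Fy.
  rewrite /F (nth_map [ffun=> ord0]) -?cardE//; set c := nth _ _ _.
  move=> [q [Mq qc] <-] [q' [Mq' qc'] <-]; rewrite lee_fin.
  apply: le_trans (lipG _ _ Mq Mq') _; apply: ler_wpM2l => //.
  apply: le_norm_coord => [|i]; first exact: ltW.
  rewrite !mxE; have := qc i; have := qc' i; rewrite -natr1 mulrDl mul1r.
  move: ((c i)%:R * h) => z; rewrite ler_norml; lra.
rewrite ifT; last by apply: le_trans diamF _; rewrite lee_fin.
rewrite /b EFinM EFin_expe; apply: lee_wpmul2l.
  by rewrite lee_fin unit_ball_volume_ge0.
apply: le_expe; first by rewrite mule_ge0 ?ediam_ge0// lee_fin invr_ge0.
by rewrite EFinM lee_wpmul2r// lee_fin invr_ge0.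
Qed.

End lipschitz_image.
Section euclidean_norm.
Context (R : realType) (n : nat).
Implicit Types (v : 'rV[R]_n) (Q : 'M[R]_n).

Lemma sqr_enorm v : enorm v ^+ 2 = \sum_(i < n) v 0 i ^+ 2.
Proof. by rewrite sqr_sqrtr// sumr_ge0// => i _; exact: sqr_ge0. Qed.

Lemma enorm_ge0 v : 0 <= enorm v.
Proof. exact: sqrtr_ge0. Qed.

Lemma enormE v : enorm v = Num.sqrt ((v *m v^T) 0 0).
Proof.
by rewrite /enorm mxE; congr Num.sqrt; apply: eq_bigr => i _; rewrite mxE expr2.
Qed.

Lemma enorm_mul_orthogonal Q v : Q *m Q^T = 1%:M -> enorm (v *m Q) = enorm v.
Proof.
by move=> QQ; rewrite !enormE trmx_mul mulmxA -(mulmxA v) QQ mulmx1.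
Qed.

Lemma enorm_le_norm v : enorm v <= n%:R * `|v|.
Proof.
rewrite -[leRHS]ger0_norm ?mulr_ge0// -sqrtr_sqr ler_sqrt ?sqr_ge0//.
apply: (@le_trans _ _ (\sum_(i < n) `|v| ^+ 2)).
  by apply: ler_sum => i _; rewrite -real_normK ?num_real// lerXn2r ?nnegrE// le_abs_coord_norm.
rewrite sumr_const card_ord -[_ *+ _]mulr_natl exprMn ler_wpM2r ?sqr_ge0//.
by rewrite -natrX ler_nat; case: (n) => // m; rewrite expnS leq_pmulr.
Qed.

Lemma norm_le_enorm v : `|v| <= enorm v.
Proof. by apply: le_norm_coord => *; [exact: enorm_ge0|exact: le_abs_coord_enorm]. Qed.

Definition sqdist (x z : 'rV[R]_n) : R := \sum_(i < n) (x 0 i - z 0 i) ^+ 2.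

Lemma sqdist_ge0 x z : 0 <= sqdist x z.
Proof. by apply: sumr_ge0 => i _; exact: sqr_ge0. Qed.

Lemma enorm_sqdist x z : enorm (x - z) = Num.sqrt (sqdist x z).
Proof. by congr Num.sqrt; apply: eq_bigr => i _; rewrite !mxE. Qed.

Lemma continuous_sqdist z : continuous (sqdist^~ z).
Proof.
apply: continuous_big => [|i _ x]; first exact: add_continuous.
apply: (@continuous_comp 'rV[R]_n R R (fun y => y 0 i - z 0 i) (fun t => t ^+ 2)).
  exact: (cvgB (@coord_continuous R 1 n 0 i x) (cvg_cst _)).
exact: exprn_continuous.
Qed.

Lemma open_eball (p : 'rV[R]_n) r : open (eball p r).
Proof.
have -> : eball p r = (fun x => Num.sqrt (sqdist x p)) @^-1` [set t | t < r].
  by apply/funext => x; rewrite /eball /= enorm_sqdist.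
apply: open_comp; last exact: open_lt.
move=> x _; apply: (@continuous_comp _ _ _ (sqdist^~ p) Num.sqrt).
  exact: continuous_sqdist.
exact: sqrt_continuous.
Qed.

End euclidean_norm.

Section borel_sets.
Context (R : realType) (n : nat) (mu : {outer_measure set 'rV[R]_n -> \bar R}).
Hypothesis half_space : forall i c, mu.-caratheodory [set x : 'rV[R]_n | x 0 i <= c].

Lemma measurable_coord (D : set (caratheodory_type mu)) i : measurable D ->
  measurable_fun D (fun x : caratheodory_type mu => (x : 'rV[R]_n) 0 i).
Proof.
move=> mD; apply: (measurability _ (RGenOInfty.measurableE R)) => // _ [_ [a ->] <-].
apply: measurableI => //; rewrite -[X in measurable X]setCK; apply: measurableC.
rewrite (_ : ~` _ = [set x : 'rV[R]_n | x 0 i <= a]); first exact: half_space.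
by apply/seteqP; split=> x /=; rewrite in_itv/= andbT leNgt => /negP.
Qed.

Lemma open_caratheodory (V : set 'rV[R]_n) : open V -> measurable (V : set (caratheodory_type mu)).
Proof.
move=> oV; rewrite -(setTI V).
apply: (@measurable_preimage_open _ _ _ (caratheodory_type mu) setT (fun x => x) V) => // i.
exact: measurable_coord.
Qed.

Lemma measurable_continuous_on (D : set (caratheodory_type mu)) (V : set 'rV[R]_n)
    (w : 'rV[R]_n -> R) : measurable D -> open V -> D `<=` V ->
  (forall x, V x -> {for x, continuous w}) ->
  measurable_fun D (w : caratheodory_type mu -> R).
Proof.
move=> mD oV DV cw.
have := @measurable_comp_continuous R n _ (caratheodory_type mu) D (fun x => x) V w
  mD (fun i => measurable_coord i mD) oV cw.
by apply: eq_measurable_fun => x /set_mem/DV Vx; rewrite mem_set.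
Qed.

Lemma frontier_caratheodory (A : set 'rV[R]_n) :
  measurable (frontier A : set (caratheodory_type mu)).
Proof.
apply: measurableD; last exact/open_caratheodory/open_interior.
rewrite -[X in measurable X]setCK; apply: measurableC.
exact/open_caratheodory/closed_openC/closed_closure.
Qed.

End borel_sets.

Section lipschitz_boundary_measure.
Context (R : realType) (d : nat).
Implicit Types (Omega : set 'rV[R]_d.+1).

Lemma frontier_compact Omega : bounded_set Omega -> compact (frontier Omega).
Proof.
move=> bO; have [M [_ /(_ (M + 1))]] := bO.
rewrite ltrDl ltr01 => /(_ isT) OM.
apply: bounded_closed_compact.
  exists (M + 1); split; first exact: num_real.
  move=> r Mr x [clx _] /=; rewrite leNgt; apply/negP => rx.
  have [] := clx [set y : 'rV[R]_d.+1 | M + 1 < `|y|].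
    apply: open_nbhs_nbhs; split; last exact: lt_trans rx.
    have -> : [set y : 'rV[R]_d.+1 | M + 1 < `|y|] =
       (fun y : 'rV[R]_d.+1 => `|y|) @^-1` [set t | M + 1 < t] by [].
    by apply: open_comp; [move=> y _; exact: norm_continuous|exact: open_gt].
  by move=> y [/OM] /=; rewrite leNgt => /negP.
by apply: closedI; [exact: closed_closure|exact/open_closedC/open_interior].
Qed.

Lemma lipschitz_bound (phi : 'rV[R]_d -> R) : lipschitz phi ->
  exists2 L, 0 <= L & forall q q', `|phi q - phi q'| <= L * `|q - q'|.
Proof.
move=> [M [_ lipM]]; exists (Num.max 0 (M + 1)); first by rewrite le_max lexx.
move=> q q'; apply: (lipM (Num.max 0 (M + 1)) _ (q, q')) => //=.
by rewrite lt_max ltrDl ltr01 orbT.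
Qed.

(** A point strictly above the graph is interior to [Omega], and a point strictly
    below it has a neighbourhood that misses [Omega]. *)
Lemma boundary_chart_graph Omega p r Q phi x :
  open Omega -> boundary_chart Omega p r Q phi -> frontier Omega x -> eball p r x ->
  (x *m Q) 0 ord_max = phi (col' ord_max (x *m Q)).
Proof.
move=> oO [r0 QQ /lipschitz_bound[L L0 lipL] chart] [clx nintx] xp.
pose F y := (y *m Q) 0 ord_max - phi (col' ord_max (y *m Q)).
have lipF y : `|F y - F x| <= (1 + L) * (d.+1%:R * `|y - x|).
  have lecoord j : `|(y *m Q) 0 j - (x *m Q) 0 j| <= d.+1%:R * `|y - x|.
    have -> : (y *m Q) 0 j - (x *m Q) 0 j = ((y - x) *m Q) 0 j by rewrite mulmxBl !mxE.
    rewrite (le_trans (le_abs_coord_enorm _ _))// enorm_mul_orthogonal//.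
    exact: enorm_le_norm.
  have -> : F y - F x = ((y *m Q) 0 ord_max - (x *m Q) 0 ord_max) -
      (phi (col' ord_max (y *m Q)) - phi (col' ord_max (x *m Q))) by rewrite /F; ring.
  rewrite (le_trans (ler_normB _ _))// mulrDl mul1r lerD//.
  apply: le_trans (lipL _ _) _; apply: ler_wpM2l => //.
  apply: le_norm_coord => [|i]; first by rewrite mulr_ge0.
  by have := lecoord (lift ord_max i); rewrite !mxE.
apply/eqP; rewrite eq_le; apply/andP; split.
  rewrite leNgt; apply/negP => lt_x; apply: nintx.
  by apply: open_nbhs_nbhs; split=> //; apply/chart.
rewrite leNgt; apply/negP => lt_x.
have Fx0 : 0 < - F x by rewrite /F opprB subr_gt0.
pose e := - F x / ((1 + L) * d.+1%:R).
have e0 : 0 < e by rewrite divr_gt0// mulr_gt0// ltr_pwDl.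
have [] := clx (ball x e `&` eball p r).
  by apply: filterI; [exact: nbhsx_ballx|apply: open_nbhs_nbhs; split=> //; exact: open_eball].
move=> y [Oy [xy yp]]; move: Oy => /(chart _ yp); rewrite -subr_gt0 -/(F y).
have := lipF y; move: xy; rewrite -ball_normE /= distrC /e ltr_pdivlMr; last first.
  by rewrite mulr_gt0// ltr_pwDl.
rewrite mulrC mulrA ler_norml; lra.
Qed.

Lemma hausdorff_frontier_finite Omega : bounded_lipschitz_domain Omega ->
  (hausdorff_outer d (frontier Omega) < +oo)%E.
Proof.
move=> [oO _ _ bO lipO].
have cO := frontier_compact bO.
have [M M0 frM] : exists2 M, 0 < M & forall x, frontier Omega x -> `|x| <= M.
  have [M [_ /(_ (Num.max 1 (M + 1)))]] := compact_bounded cO.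
  rewrite lt_max ltrDl ltr01 orbT => /(_ isT) HM.
  by exists (Num.max 1 (M + 1)) => //; rewrite lt_max ltr01.
have chart (p : 'rV[R]_d.+1) : exists r : R, frontier Omega p -> 0 < r /\
    (hausdorff_outer d (frontier Omega `&` eball p r) < +oo)%E.
  have [frp|] := pselect (frontier Omega p); last by exists 0.
  have [r [Q [phi chart]]] := lipO _ frp; exists r => _.
  have [r0 QQ /lipschitz_bound[L L0 lipL] _] := chart; split=> //.
  pose S (q : 'rV[R]_d) : 'rV[R]_d.+1 := \row_j (if unlift ord_max j is Some i then q 0 i else phi q).
  pose G q := S q *m Q^T.
  have QQ' : Q^T *m Q^T^T = 1%:M by rewrite trmxK; exact: mulmx1C.
  have lipG q q' : enorm (G q - G q') <= d.+1%:R * (1 + L) * `|q - q'|.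
    rewrite -mulmxBl enorm_mul_orthogonal// (le_trans (enorm_le_norm _))// -mulrA.
    apply: ler_wpM2l => //; apply: le_norm_coord => [|j].
      by rewrite mulr_ge0// addr_ge0.
    rewrite !mxE; case: unliftP => [i _|_].
      apply: (@le_trans _ _ `|q - q'|); last by rewrite ler_peMl// lerDl.
      by have := le_abs_coord_norm (q - q') i; rewrite !mxE.
    by apply: le_trans (lipL _ _) _; rewrite ler_wpM2r// lerDr.
  have M'0 : 0 < d.+1%:R * M by rewrite mulr_gt0.
  have L'0 : 0 <= d.+1%:R * (1 + L) by rewrite mulr_ge0// addr_ge0.
  apply: (@le_lt_trans _ _ (hausdorff_outer d (G @` cube (d.+1%:R * M)))); last first.
    by apply: le_lt_trans (hausdorff_lipschitz_image L'0 M'0 (fun q q' _ _ => lipG q q')) _; rewrite ltry.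
  apply: le_outer_measure => x [frx xp]; exists (col' ord_max (x *m Q)).
    move=> i; rewrite mxE (le_trans (le_abs_coord_enorm _ _))// enorm_mul_orthogonal//.
    by rewrite (le_trans (enorm_le_norm _))// ler_wpM2l// frM.
  rewrite /G; have -> : S (col' ord_max (x *m Q)) = x *m Q.
    apply/rowP => j; rewrite mxE; case: unliftP => [i ->|->]; first by rewrite mxE.
    by rewrite -(boundary_chart_graph oO chart frx xp).
  by rewrite -mulmxA QQ mulmx1.
have [r rP] := choice chart.
have cov : frontier Omega `<=` cover (frontier Omega) (fun p => eball p (r p)).
  move=> x frx; exists x => //; rewrite /eball /= subrr /enorm big1 ?sqrtr0//.
    by case: (rP x frx).
  by move=> i _; rewrite mxE expr0n.
have oe (p : 'rV[R]_d.+1) : frontier Omega p -> open (eball p (r p)).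
  by move=> _; exact: open_eball.
move: cO; rewrite compact_cover => /(_ _ _ _ oe cov).
move=> [D' D'fr frD'].
pose s : seq 'rV[R]_d.+1 := finmap.enum_fset D'.
apply: (@le_lt_trans _ _ (hausdorff_outer d
    (\big[setU/set0]_(p <- s) (frontier Omega `&` eball p (r p))))).
  apply: le_outer_measure => x frx; have [p pD xp] := frD' _ frx.
  by rewrite -bigcup_seq; exists p.
have : {in s, forall p, frontier Omega p} by move=> p /D'fr; exact: set_mem.
elim: s => [_|p s IH ps]; first by rewrite big_nil outer_measure0.
rewrite big_cons; apply: le_lt_trans (outer_measureU2 _ _ _) _.
rewrite lte_add_pinfty//; first by case: (rP p (ps p (mem_head _ _))).
by apply: IH => q qs; apply: ps; rewrite in_cons qs orbT.
Qed.

End lipschitz_boundary_measure.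
(** * Entire series and the radial Helmholtz equation *)

Section entire_series.
Context (R : realType).
Implicit Types (c : R^nat) (s : R).

(** This class of coefficients is stable under termwise differentiation, so that
    all derivatives of the sums are sums of the same kind. *)
Definition entire_coeff c := forall m, `|c m| <= m`!%:R^-1.

Definition psum c s := limn (pseries c s).

Lemma entire_coeff_diffs c : entire_coeff c -> entire_coeff (pseries_diffs c).
Proof.
move=> hc m; rewrite /pseries_diffs normrM ger0_norm// mulrC.
rewrite -ler_pdivlMr ?ltr0n//; apply: le_trans (hc _) _.
by rewrite factS natrM invfM mulrC.
Qed.

Lemma cvg_entire_series c s : entire_coeff c -> cvgn (pseries c s).
Proof.
move=> hc; apply: normed_cvg; apply: series_le_cvg (is_cvg_series_exp_coeff `|s|) => //.
- by move=> m /=.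
- by move=> m; exact: exp_coeff_ge0.
- by move=> m; rewrite /= normrM normrX mulrC; apply: ler_wpM2l => //; exact: exprn_ge0.
Qed.

Lemma is_derive_psum c s : entire_coeff c ->
  is_derive s 1 (psum c) (psum (pseries_diffs c) s).
Proof.
move=> hc; apply: (@pseries_snd_diffs _ _ (`|s| + 1)).
- exact: cvg_entire_series.
- exact/cvg_entire_series/entire_coeff_diffs.
- exact/cvg_entire_series/entire_coeff_diffs/entire_coeff_diffs.
- by rewrite [ltRHS]ger0_norm ?addr_ge0// ltrDl.
Qed.

Lemma continuous_psum c : entire_coeff c -> continuous (psum c).
Proof.
move=> hc s; apply: differentiable_continuous; apply/derivable1_diffP.
by have [] := is_derive_psum s hc.
Qed.

Lemma psum0 c : psum c 0 = c 0.
Proof.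
apply: lim_near_cst => //; near=> m.
rewrite /pseries /series /= -[m]prednK; last by near: m; exact: nbhs_infty_gt.
rewrite big_nat_recl// expr0 mulr1 big1 ?addr0// => i _.
by rewrite expr0n /= mulr0.
Unshelve. all: by end_near. Qed.

(** [psum c (t ^+ 2)] with these coefficients is the radial solution, equal
    to [1] at the origin, of the Helmholtz equation in dimension [n]: the
    recurrence on [c] is [4 * s * g'' + 2 * n * g' + g = 0] for [g = psum c]. *)
Definition helmholtz_coeff (n : nat) c :=
  c 0 = 1 /\ forall m, 4 * (m * m.+1)%:R * c m.+1 + 2 * n%:R * m.+1%:R * c m.+1 + c m = 0.

(** The partial sums of the left-hand side vanish, provided that the series of [g'']
    is stopped one term earlier than the other two. *)
Lemma helmholtz_ode n c s : entire_coeff c -> helmholtz_coeff n c ->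
  4 * s * psum (pseries_diffs (pseries_diffs c)) s +
  2 * n%:R * psum (pseries_diffs c) s + psum c s = 0.
Proof.
move=> hc [_ rec].
pose u m := 4 * s * series (fun i => pseries_diffs (pseries_diffs c) i * s ^+ i) m +
  2 * n%:R * series (fun i => pseries_diffs c i * s ^+ i) m.+1 +
  series (fun i => c i * s ^+ i) m.+1.
have u0 m : u m = 0.
  elim: m => [|m IH].
    rewrite /u /series /= big_geq// !big_nat1 mulr0 add0r expr0 !mulr1 /pseries_diffs.
    by rewrite -[RHS](rec 0%N) mul0n mulr0 mul0r add0r mul1r !mulr1.
  have := congr1 (fun x => x * s ^+ m.+1) (rec m.+1); rewrite mul0r => stepE.
  rewrite -[RHS]addr0 -[X in _ = _ + X]stepE -[X in _ = X + _]IH /u /series /=.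
  rewrite big_nat_recr//= [X in 2 * n%:R * X]big_nat_recr//=.
  rewrite [X in _ + X = _]big_nat_recr//= /pseries_diffs natrM exprS.
  move: (\sum_(0 <= i < m) _) (\sum_(0 <= i < m.+1) _) (\sum_(0 <= i < m.+1) _) => A B C.
  by ring.
have : u m @[m --> \oo] --> 4 * s * psum (pseries_diffs (pseries_diffs c)) s +
    2 * n%:R * psum (pseries_diffs c) s + psum c s.
  apply: cvgD; first apply: cvgD.
  - by apply: cvgMr; exact/cvg_entire_series/entire_coeff_diffs/entire_coeff_diffs.
  - by apply: cvgMr; rewrite cvg_shiftS; exact/cvg_entire_series/entire_coeff_diffs.
  - by rewrite cvg_shiftS; exact: cvg_entire_series.
move=> /cvg_lim <- //; apply: lim_near_cst => //; exact: nearW.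
Qed.

(** The energy [g ^+ 2 + 4 * s * g' ^+ 2], which is [u ^+ 2 + u' ^+ 2] for
    [u t = g (t ^+ 2)], has derivative [- 4 * (n - 1) * g' ^+ 2] along the
    Helmholtz equation. *)
Lemma helmholtz_energy_le1 n c s : (0 < n)%N -> entire_coeff c -> helmholtz_coeff n c ->
  0 <= s -> psum c s ^+ 2 + 4 * s * psum (pseries_diffs c) s ^+ 2 <= 1.
Proof.
move=> n0 hc hn; have [c0 _] := hn.
set g := psum c; set g1 := psum (pseries_diffs c).
set g2 := psum (pseries_diffs (pseries_diffs c)).
pose e x := g x ^+ 2 + 4 * x * g1 x ^+ 2.
have dg (x : R) : is_derive x 1 g (g1 x) by exact: is_derive_psum.
have dg1 (x : R) : is_derive x 1 g1 (g2 x).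
  exact/is_derive_psum/entire_coeff_diffs.
have de (x : R) : is_derive x 1 e (- (4 * (n%:R - 1)) * g1 x ^+ 2).
  have H : is_derive x 1 e (2 * g x * g1 x + (4 * g1 x ^+ 2 + 8 * x * g1 x * g2 x)).
    rewrite /e; apply: is_derive_eq.
    rewrite /GRing.scale /=; ring.
  apply: is_derive_eq; have := helmholtz_ode x hc hn; rewrite -/g -/g1 -/g2 => ode.
  have -> : g x = - (4 * x * g2 x + 2 * n%:R * g1 x).
    by apply/eqP; rewrite -addr_eq0 addrC; apply/eqP.
  ring.
move=> s0; rewrite -[leLHS]/(e s).
have e0 : e 0 = 1 by rewrite /e mulr0 mul0r addr0 /g psum0 c0 expr1n.
have ce : {within `[0, s], continuous e}.
  apply: continuous_subspaceT => x; apply: differentiable_continuous.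
  by apply/derivable1_diffP; have [] := de x.
have [x _ es] := MVT_segment s0 (fun x _ => de x) ce.
rewrite -e0 -subr_le0 es mulr_le0_ge0 ?subr0// mulNr oppr_le0 mulr_ge0 ?sqr_ge0//.
by rewrite mulr_ge0// subr_ge0 ler1n.
Qed.

End entire_series.
(** * The imaginary part of the Green's function *)

Section radial_functions.
Context (R : realType) (n : nat).
Implicit Types (x z v : 'rV[R]_n).

Lemma is_derive_line (w : 'rV[R]_n -> R) x v (l : R) :
  is_derive (0 : R) 1 (fun h => w (h *: v + x)) l -> is_derive x v w l.
Proof.
have lineE : (fun h : R => h^-1 *: (((fun h => w (h *: v + x)) \o shift 0) (h *: 1) -
    w (0 *: v + x))) = (fun h => h^-1 *: ((w \o shift x) (h *: v) - w x)).
  by apply/funext => h; rewrite /= /shift addr0 scale0r add0r [h *: 1]mulr1.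
move=> [dw lw]; split; first by move: dw; rewrite /derivable lineE.
by rewrite -lw /derive lineE.
Qed.

Lemma sqdist_line x z v (h : R) : sqdist (h *: v + x) z =
  sqdist x z + h * (2 * \sum_(i < n) v 0 i * (x 0 i - z 0 i)) + h ^+ 2 * \sum_(i < n) v 0 i ^+ 2.
Proof.
rewrite /sqdist !mulr_sumr -!big_split /=; apply: eq_bigr => i _.
by rewrite !mxE; ring.
Qed.

Lemma is_derive_radial_line (g : R -> R) (dg h0 : R) x z v :
  is_derive (sqdist (h0 *: v + x) z) 1 g dg ->
  is_derive h0 1 (fun h => g (sqdist (h *: v + x) z))
    (dg * (2 * \sum_(i < n) v 0 i * ((h0 *: v + x) 0 i - z 0 i))).
Proof.
have -> : 2 * \sum_(i < n) v 0 i * ((h0 *: v + x) 0 i - z 0 i) =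
    2 * (\sum_(i < n) v 0 i * (x 0 i - z 0 i)) + 2 * h0 * \sum_(i < n) v 0 i ^+ 2.
  rewrite !mulr_sumr -big_split /=; apply: eq_bigr => i _; rewrite !mxE; ring.
have -> : (fun h : R => g (sqdist (h *: v + x) z)) = g \o
    (fun h => sqdist x z + h * (2 * \sum_(i < n) v 0 i * (x 0 i - z 0 i)) +
       h ^+ 2 * \sum_(i < n) v 0 i ^+ 2).
  by apply/funext => h; rewrite /= sqdist_line.
rewrite sqdist_line.
set A := sqdist x z; set B := 2 * _; set C := \sum_(i < n) v 0 i ^+ 2 => Hg.
have H : is_derive h0 1 (fun h : R => A + h * B + h ^+ 2 * C) (B + 2 * h0 * C).
  by apply: is_derive_eq; rewrite /GRing.scale /=; ring.
exact: is_derive1_comp.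
Qed.

Lemma is_derive_radial (g : R -> R) (dg : R) x z v :
  is_derive (sqdist x z) 1 g dg ->
  is_derive x v (fun y => g (sqdist y z)) (dg * (2 * \sum_(i < n) v 0 i * (x 0 i - z 0 i))).
Proof.
move=> Hg; apply: is_derive_line.
have x0 : 0 *: v + x = x by rewrite scale0r add0r.
have := @is_derive_radial_line g dg 0 x z v; rewrite x0; exact.
Qed.

Lemma continuous_radial (g : R -> R) x z : derivable g (sqdist x z) 1 ->
  {for x, continuous (fun y : 'rV[R]_n => g (sqdist y z))}.
Proof.
move=> dg; have cg : {for sqdist x z, continuous g}.
  by apply: differentiable_continuous; exact/derivable1_diffP.
exact: (@continuous_comp 'rV[R]_n R R (fun y => sqdist y z) g x (@continuous_sqdist R n z x) cg).
Qed.

End radial_functions.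

Section imaginary_part.
Context (R : realType).

(** [besselJ0 t] and [sphericalJ0 t] are even in [t], hence entire series in
    [t ^+ 2]; these are their coefficients. *)
Definition bessel_coeff (m : nat) : R := (-1) ^+ m / (m`!%:R ^+ 2 * 4 ^+ m).

Definition sinc_coeff (m : nat) : R := (-1) ^+ m / (m.*2.+1)`!%:R.

Lemma norm_sign_div (m : nat) (x : R) : 0 <= x -> `|(-1) ^+ m / x| = x^-1.
Proof. by move=> x0; rewrite normrM normrX normrN1 expr1n mul1r ger0_norm ?invr_ge0. Qed.

Lemma bessel_entire : entire_coeff bessel_coeff.
Proof.
move=> m; rewrite norm_sign_div ?mulr_ge0 ?sqr_ge0 ?exprn_ge0//.
have f1 : 1 <= m`!%:R :> R by rewrite ler1n fact_gt0.
have f0 : 0 < m`!%:R :> R by rewrite ltr0n fact_gt0.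
rewrite lef_pV2 ?posrE ?mulr_gt0 ?exprn_gt0//.
by rewrite expr2 -mulrA ler_peMr ?(ltW f0)// mulr_ege1// exprn_ege1// ler1n.
Qed.

Lemma bessel_helmholtz : helmholtz_coeff 2 bessel_coeff.
Proof.
split; first by rewrite /bessel_coeff fact0 !expr0 expr1n mulr1 divr1.
move=> m; rewrite /bessel_coeff factS !natrM (exprS (-1)) (exprS 4 m) -[m.+1%:R]natr1.
have : m`!%:R != 0 :> R by rewrite pnatr_eq0 -lt0n fact_gt0.
have : m%:R + 1 != 0 :> R by rewrite natr1 pnatr_eq0.
have : 4 ^+ m != 0 :> R by rewrite expf_neq0// pnatr_eq0.
move: (m`!%:R : R) (m%:R : R) (4 ^+ m : R) ((-1) ^+ m : R) => F M P S P0 M0 F0.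
by field; rewrite F0 M0 P0.
Qed.

Lemma sinc_entire : entire_coeff sinc_coeff.
Proof.
move=> m; rewrite norm_sign_div//.
rewrite lef_pV2 ?posrE ?ltr0n ?fact_gt0// ler_nat.
have leq_fact : {homo factorial : i j / (i <= j)%N}.
  by apply: homo_leq leqnn leq_trans _ => i; rewrite factS leq_pmull.
by apply: leq_fact; rewrite -addnn -addSn leq_addl.
Qed.

Lemma sinc_helmholtz : helmholtz_coeff 3 sinc_coeff.
Proof.
split; first by rewrite /sinc_coeff expr0 divr1.
move=> m; rewrite /sinc_coeff doubleS !factS !natrM exprS.
have F0 : (m.*2)`!%:R != 0 :> R by rewrite pnatr_eq0 -lt0n fact_gt0.
have m1 : m.*2.+1%:R = 2 * m%:R + 1 :> R by rewrite -[LHS]natr1 -muln2 natrM mulrC.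
have m2 : m.*2.+2%:R = 2 * m%:R + 2 :> R by rewrite -[LHS]natr1 m1; ring.
have m3 : m.*2.+3%:R = 2 * m%:R + 3 :> R by rewrite -[LHS]natr1 m2; ring.
have n1 : 2 * m%:R + 1 != 0 :> R by rewrite -m1 pnatr_eq0.
have n2 : 2 * m%:R + 2 != 0 :> R by rewrite -m2 pnatr_eq0.
have n3 : 2 * m%:R + 3 != 0 :> R by rewrite -m3 pnatr_eq0.
rewrite m1 m2 m3 -[m.+1%:R]natr1; move: (_`!%:R : R) (m%:R : R) ((-1) ^+ m : R) F0 n1 n2 n3.
by move=> F M S F0 n1 n2 n3; field; rewrite F0 n1 n2 n3.
Qed.

Lemma half_expr_double (t : R) m : (t / 2) ^+ m.*2 = (t ^+ 2) ^+ m * (4 ^+ m)^-1.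
Proof.
have e4 : (4 : R) = 2 ^+ 2 by rewrite expr2; ring.
by rewrite -mul2n exprM expr_div_n -e4 expr_div_n.
Qed.

Lemma besselJ0_psum (t : R) : besselJ0 t = psum bessel_coeff (t ^+ 2).
Proof.
congr (limn (series _)); apply/funext => m; rewrite /bessel_coeff.
by rewrite half_expr_double /= [in RHS]invfM [in RHS]mulrA [RHS]mulrAC !mulrA.
Qed.

Lemma sphericalJ0_psum (t : R) : sphericalJ0 t = psum sinc_coeff (t ^+ 2).
Proof.
rewrite /sphericalJ0; case: eqP => [->|/eqP t0].
  by rewrite expr0n psum0 /sinc_coeff expr0 divr1.
apply: (mulfI t0); rewrite mulrC divfK//.
have /cvg_lim <- // : series (sin_coeff' t) m @[m --> \oo] --> sin t.
  exact: cvg_sin_coeff'.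
have -> : series (sin_coeff' t) = (fun m => t * pseries sinc_coeff (t ^+ 2) m).
  apply/funext => m; rewrite /pseries /series /= mulr_sumr; apply: eq_bigr => i _.
  rewrite /sin_coeff' /sinc_coeff /= -exprnP -exprM mul2n exprS.
  move: ((-1) ^+ i : R) (t ^+ _) ((_`!%:R)^-1 : R) => A B C; ring.
apply: cvg_lim => //; apply: cvgMr; exact: cvg_entire_series sinc_entire.
Qed.

Definition im_coeff (n : nat) : R^nat := if n == 2 then bessel_coeff else sinc_coeff.

Definition im_factor (n : nat) (k : R) : R := if n == 2 then 4^-1 else k / (4 * pi).

Lemma im_entire n : entire_coeff (im_coeff n).
Proof. by rewrite /im_coeff; case: ifP => _; [exact: bessel_entire|exact: sinc_entire]. Qed.

Lemma im_helmholtz n : n = 2%N \/ n = 3%N -> helmholtz_coeff n (im_coeff n).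
Proof. by move=> [->|->]; [exact: bessel_helmholtz|exact: sinc_helmholtz]. Qed.

Lemma im_factor_ge0 n (k : R) : 0 < k -> 0 <= im_factor n k.
Proof.
by move=> k0; rewrite /im_factor; case: ifP => _; rewrite ?divr_ge0 ?mulr_ge0 ?pi_ge0// ltW.
Qed.

Definition im_radial n (k s : R) : R := im_factor n k * psum (im_coeff n) (k ^+ 2 * s).

Lemma imPhi_radial n (k : R) (x z : 'rV[R]_n) : imPhi k x z = im_radial n k (sqdist x z).
Proof.
rewrite /imPhi /im_radial /im_factor /im_coeff besselJ0_psum sphericalJ0_psum exprMn.
rewrite enorm_sqdist sqr_sqrtr ?sqdist_ge0//; case: ifP => // _; exact: mulrC.
Qed.

Lemma is_derive_im_radial n (k s : R) : is_derive s 1 (im_radial n k)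
  (im_factor n k * (k ^+ 2 * psum (pseries_diffs (im_coeff n)) (k ^+ 2 * s))).
Proof.
have d1 : is_derive s 1 (fun s : R => k ^+ 2 * s) (k ^+ 2).
  by apply: is_derive_eq; rewrite /GRing.scale /= mulr1.
have d2 := is_derive1_comp (is_derive_psum (k ^+ 2 * s) (im_entire n)) d1.
have d3 : is_derive s 1
    (fun s => im_factor n k * (psum (im_coeff n) \o (fun s : R => k ^+ 2 * s)) s)
    (im_factor n k * (k ^+ 2 * psum (pseries_diffs (im_coeff n)) (k ^+ 2 * s))).
  by apply: is_derive_eq; rewrite /GRing.scale /=; ring.
exact: d3.
Qed.

Lemma is_derive_imPhi n (k : R) (x z v : 'rV[R]_n) :
  is_derive x v (fun y => imPhi k y z)
    (im_factor n k * (k ^+ 2 * psum (pseries_diffs (im_coeff n)) (k ^+ 2 * sqdist x z)) *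
     (2 * \sum_(i < n) v 0 i * (x 0 i - z 0 i))).
Proof.
under eq_fun do rewrite imPhi_radial; apply: is_derive_radial; exact: is_derive_im_radial.
Qed.

Lemma continuous_imPhi n (k : R) (z : 'rV[R]_n) : continuous (fun y : 'rV[R]_n => imPhi k y z).
Proof.
move=> x; under eq_fun do rewrite imPhi_radial; apply: continuous_radial.
by have [] := is_derive_im_radial n k (sqdist x z).
Qed.

Lemma norm_imPhi_le n (k : R) (x z : 'rV[R]_n) : n = 2%N \/ n = 3%N -> 0 < k ->
  `|imPhi k x z| <= im_factor n k.
Proof.
move=> n23 k0; rewrite imPhi_radial normrM (ger0_norm (im_factor_ge0 n k0)).
rewrite ler_piMr ?im_factor_ge0// -(expr_le1 (ltn0Sn 1))// real_normK ?num_real//.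
have s0 : 0 <= k ^+ 2 * sqdist x z by rewrite mulr_ge0 ?sqr_ge0 ?sqdist_ge0.
have n0 : (0 < n)%N by case: n23 => ->.
apply: le_trans (helmholtz_energy_le1 n0 (im_entire n) (im_helmholtz n23) s0).
by rewrite lerDl mulr_ge0 ?sqr_ge0// mulr_ge0.
Qed.

(** With [r = |x - z|], the energy bounds [2 * k * r * |g'|] by [1], while the
    derivative of [k ^+ 2 * |x - z| ^+ 2] along a unit vector is at most
    [2 * n * k ^+ 2 * r]; the product is at most [n * k], whatever [z] is. *)
Lemma norm_derive_imPhi_le n (k : R) (x z v : 'rV[R]_n) : n = 2%N \/ n = 3%N -> 0 < k ->
  enorm v <= 1 -> `|'D_v (fun y => imPhi k y z) x| <= n%:R * im_factor n k * k.
Proof.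
move=> n23 k0 v1; have [_ ->] := is_derive_imPhi k x z v.
set g1 := psum _ _; set a := im_factor n k; set S := \sum_(i < n) _.
have a0 : 0 <= a by exact: im_factor_ge0.
pose r := Num.sqrt (sqdist x z).
have r0 : 0 <= r by exact: sqrtr_ge0.
have Sle : `|S| <= n%:R * r.
  rewrite (le_trans (ler_norm_sum _ _ _))//.
  apply: (@le_trans _ _ (\sum_(i < n) r)); last by rewrite sumr_const card_ord mulr_natl.
  apply: ler_sum => i _; rewrite normrM -[leRHS]mul1r ler_pM//.
    exact: le_trans (le_abs_coord_enorm _ _) v1.
  by have := le_abs_coord_enorm (x - z) i; rewrite enorm_sqdist !mxE.
have g1le : 2 * k * r * `|g1| <= 1.
  rewrite -(expr_le1 (ltn0Sn 1)); last by rewrite !mulr_ge0// ltW.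
  have s0 : 0 <= k ^+ 2 * sqdist x z by rewrite mulr_ge0 ?sqr_ge0 ?sqdist_ge0.
  have n0 : (0 < n)%N by case: n23 => ->.
  apply: le_trans (helmholtz_energy_le1 n0 (im_entire n) (im_helmholtz n23) s0).
  rewrite -/g1 !exprMn real_normK ?num_real// sqr_sqrtr ?sqdist_ge0//.
  apply: (@le_trans _ _ (4 * (k ^+ 2 * sqdist x z) * g1 ^+ 2)); last by rewrite lerDr sqr_ge0.
  by rewrite le_eqVlt; apply/orP; left; apply/eqP; ring.
rewrite 2!normrM [`|k ^+ 2 * g1|]normrM [`|2 * S|]normrM.
rewrite (ger0_norm a0) (ger0_norm (sqr_ge0 k)) (@ger0_norm _ 2)//.
apply: (@le_trans _ _ (a * (k ^+ 2 * `|g1|) * (2 * (n%:R * r)))).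
  by apply: ler_wpM2l; [by rewrite mulr_ge0// mulr_ge0// sqr_ge0|exact: ler_wpM2l].
have -> : a * (k ^+ 2 * `|g1|) * (2 * (n%:R * r)) = n%:R * a * k * (2 * k * r * `|g1|) by ring.
by rewrite ler_piMr// !mulr_ge0// ltW.
Qed.

End imaginary_part.
(** * The Green's function off the diagonal *)

Section continuously_differentiable.
Context (R : realType).
Implicit Types (g : R -> R).

(** Green's functions are radial with a singularity at the origin; as functions of
    [s = |x - y| ^+ 2] they are continuously differentiable for [0 < s]. *)
Definition C1pos g := exists2 dg : R -> R,
  (forall s : R, 0 < s -> is_derive s 1 g (dg s)) &
  (forall s : R, 0 < s -> {for s, continuous dg}).

Lemma C1pos_continuous g s : C1pos g -> 0 < s -> {for s, continuous g}.
Proof.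
move=> [dg gP _] s0; apply: differentiable_continuous; apply/derivable1_diffP.
by have [] := gP s s0.
Qed.

Lemma C1pos_cst (a : R) : C1pos (fun=> a).
Proof. by exists (fun=> 0) => [s _|s _]; [exact: is_derive_cst|exact: cst_continuous]. Qed.

Lemma C1pos_id : C1pos (fun s : R => s).
Proof. by exists (fun=> 1) => [s _|s _]; [exact: is_derive_id|exact: cst_continuous]. Qed.

Lemma C1pos_add g1 g2 : C1pos g1 -> C1pos g2 -> C1pos (fun s => g1 s + g2 s).
Proof.
move=> [d1 D1 c1] [d2 D2 c2]; exists (fun s : R => d1 s + d2 s) => s s0.
  by have := D1 s s0; have := D2 s s0 => ? ?; exact: is_deriveD.
by apply: cvgD; [exact: c1|exact: c2].
Qed.

Lemma C1pos_mul g1 g2 : C1pos g1 -> C1pos g2 -> C1pos (fun s => g1 s * g2 s).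
Proof.
move=> C1 C2; have [d1 D1 c1] := C1; have [d2 D2 c2] := C2.
exists (fun s => g1 s * d2 s + g2 s * d1 s) => s s0.
  by have := D1 s s0; have := D2 s s0 => ? ?; exact: is_deriveM.
apply: cvgD; apply: cvgM; [exact: (C1pos_continuous C1 s0)|exact: c2|
  exact: (C1pos_continuous C2 s0)|exact: c1].
Qed.

Lemma C1pos_comp (F dF : R -> R) g : (forall t : R, is_derive t 1 F (dF t)) ->
  continuous dF -> C1pos g -> C1pos (fun s => F (g s)).
Proof.
move=> FP cF Cg; have [dg gP cg] := Cg.
exists (fun s => dF (g s) * dg s) => s s0.
  by have := gP s s0; exact: (is_derive1_comp (FP (g s))).
apply: cvgM; last exact: cg.
exact: (continuous_comp (C1pos_continuous Cg s0) (cF (g s))).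
Qed.

Lemma C1pos_ln : C1pos (@ln R).
Proof.
exists (fun s => s^-1) => [s s0|s s0]; first exact: is_derive1_ln.
by apply: inv_continuous; rewrite gt_eqF.
Qed.

Lemma C1pos_psum c g : entire_coeff c -> C1pos g -> C1pos (fun s => psum c (g s)).
Proof.
move=> hc; apply: (@C1pos_comp (psum c) (psum (pseries_diffs c))).
  by move=> t; exact: is_derive_psum.
exact/continuous_psum/entire_coeff_diffs.
Qed.

(** Sup and Lipschitz bounds hold on a compact interval that avoids the
    singularity; the derivative is quantified after [M] because it is determined
    by [g]. *)
Lemma C1pos_bounds g (a b : R) : C1pos g -> 0 < a -> a <= b -> exists M : R, 0 <= M /\
  forall (dg : R -> R), (forall s : R, 0 < s -> is_derive s 1 g (dg s)) ->
  forall s, a <= s <= b ->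
  [/\ `|g s| <= M, `|dg s| <= M & forall t, a <= t <= b -> `|g s - g t| <= M * `|s - t|].
Proof.
move=> Cg a0 ab; have [dg gP cdg] := Cg.
have pos s : a <= s <= b -> 0 < s by move=> /andP[+ _]; exact: lt_le_trans.
have bnd w : (forall s : R, 0 < s -> {for s, continuous w}) ->
    exists M : R, forall s, a <= s <= b -> `|w s| <= M.
  move=> cw; have [|c _ cP] := @EVT_max R (fun s => `|w s|) a b ab.
    apply: continuous_in_subspaceT => s /set_mem; rewrite /= in_itv /= => /pos s0.
    by apply: (@continuous_comp _ _ _ w Num.norm); [exact: cw|exact: norm_continuous].
  by exists `|w c| => s sab; apply: cP; rewrite in_itv.
have [M1 M1P] := bnd _ g (fun s s0 => C1pos_continuous Cg s0).
have [M2 M2P] := bnd _ dg cdg.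
exists (Num.max 0 (Num.max M1 M2)); split; first by rewrite le_max lexx.
move=> dg' gP' s sab.
have M2le t : a <= t <= b -> `|dg t| <= Num.max 0 (Num.max M1 M2).
  by move=> tab; rewrite !le_max M2P// !orbT.
have dgE t : 0 < t -> dg' t = dg t.
  by move=> t0; have [_ <-] := gP' t t0; have [_ <-] := gP t t0.
split; [by rewrite !le_max M1P// orbT|by rewrite dgE ?pos//; exact: M2le|].
move=> t tab; wlog st : s t sab tab / t <= s.
  move=> H; have [ts|/ltW st] := leP t s; first exact: H.
  by rewrite distrC (distrC s); exact: H.
have gder (u : R) : u \in `]t, s[%R -> is_derive u 1 g (dg u).
  by rewrite in_itv/= => /andP[tu us]; apply/gP/(lt_trans _ tu)/pos.
have gcont : {within `[t, s], continuous g}.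
  apply: continuous_in_subspaceT => u /set_mem; rewrite /= in_itv /= => /andP[tu us].
  by apply: (C1pos_continuous Cg); apply: lt_le_trans tu; exact: pos.
have [c] := MVT_segment st gder gcont.
rewrite in_itv/= => /andP[tc cs] ->; rewrite normrM ler_wpM2r//; apply: M2le.
move: tab sab => /andP[at_ _] /andP[_ sb].
by rewrite (le_trans at_ tc) (le_trans cs sb).
Qed.

End continuously_differentiable.

Section green_function.
Context (R : realType).

(** The coefficients of the second series in the expansion of [besselY0]. *)
Definition harmonic_coeff (m : nat) : R := series harmonic m * bessel_coeff R m.

Lemma harmonic_entire : entire_coeff harmonic_coeff.
Proof.
move=> m; rewrite normrM norm_sign_div; last by rewrite mulr_ge0 ?sqr_ge0 ?exprn_ge0.
have H0 : 0 <= series (@harmonic R) m.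
  by rewrite /series /= sumr_ge0// => i _; exact: harmonic_ge0.
have Hm : series (@harmonic R) m <= 4 ^+ m.
  apply: (@le_trans _ _ m%:R).
    rewrite /series /= -[leRHS]mulr1 -(subn0 m) mulr_natl -sumr_const_nat subn0.
    by apply: ler_sum_nat => i _; rewrite invf_le1 ?ltr0n// ler1n.
  by rewrite -natrX ler_nat ltnW// ltn_expl.
have f1 : 1 <= m`!%:R :> R by rewrite ler1n fact_gt0.
have f0 : 0 < m`!%:R :> R by rewrite ltr0n fact_gt0.
rewrite ger0_norm// ler_pdivrMr ?mulr_gt0 ?exprn_gt0//.
rewrite expr2 -mulrA mulKf ?gt_eqF//.
by rewrite (le_trans Hm)// ler_peMl// exprn_ge0.
Qed.

(** The real part of the Green's function with [s = |x - y| ^+ 2].  Writing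
    [Num.sqrt s] as [expR (2^-1 * ln s)] makes it a composition of functions whose
    derivatives are known and continuous for [0 < s]. *)
Definition re_radial (n : nat) (k s : R) : R :=
  if n == 2 then
    - (4^-1 * (2 / pi * ((ln (k / 2) + 2^-1 * ln s + euler_gamma R) *
         psum (bessel_coeff R) (k ^+ 2 * s) - psum harmonic_coeff (k ^+ 2 * s))))
  else cos (k * expR (2^-1 * ln s)) * (expR (- (2^-1 * ln s)) / (4 * pi)).

Lemma C1pos_re_radial n k : C1pos (re_radial n k).
Proof.
have Cln a : C1pos (fun s : R => a * ln s).
  by apply: C1pos_mul; [exact: C1pos_cst|exact: C1pos_ln].
have Cid : C1pos (fun s : R => k ^+ 2 * s).
  by apply: C1pos_mul; [exact: C1pos_cst|exact: C1pos_id].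
have CcM a g : C1pos g -> C1pos (fun s : R => a * g s).
  by move=> Cg; apply: C1pos_mul => //; exact: C1pos_cst.
have CN g : C1pos g -> C1pos (fun s : R => - g s).
  move=> /(CcM (-1)); congr C1pos; apply/funext => s; exact: mulN1r.
rewrite /re_radial; case: (n == 2%N).
  apply/CN/CcM/CcM/C1pos_add; last exact/CN/(C1pos_psum harmonic_entire Cid).
  apply: C1pos_mul; last exact: (C1pos_psum (@bessel_entire R) Cid).
  apply: C1pos_add; last exact: C1pos_cst.
  by apply: C1pos_add => //; exact: C1pos_cst.
apply: C1pos_mul.
  apply: (C1pos_comp (@is_derive_cos R)).
    by move=> t; apply: continuousN; exact: continuous_sin.
  apply: CcM; apply: (C1pos_comp (@is_derive_expR R)) (Cln _); exact: continuous_expR.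
apply: C1pos_mul; last exact: C1pos_cst.
apply: (C1pos_comp (@is_derive_expR R)); first exact: continuous_expR.
exact/CN/Cln.
Qed.

Lemma C1pos_im_radial n (k : R) : C1pos (im_radial n k).
Proof.
apply: C1pos_mul; first exact: C1pos_cst.
apply: C1pos_psum; first exact: im_entire.
by apply: C1pos_mul; [exact: C1pos_cst|exact: C1pos_id].
Qed.

Lemma Re_Phi n (k : R) (x y : 'rV[R]_n) : 0 < k -> x != y ->
  complex.Re (Phi k x y) = re_radial n k (sqdist x y).
Proof.
move=> k0 xy; rewrite /Phi /re_radial enorm_sqdist; set s := sqdist x y.
have s0 : 0 < s.
  by rewrite -sqrtr_gt0 -enorm_sqdist lt_neqAle enorm_ge0 eq_sym enorm_eq0 subr_eq0 xy.
have sqrtE : Num.sqrt s = expR (2^-1 * ln s).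
  rewrite -[s in LHS]lnK// -[LHS]/(Num.sqrt (expR (ln s))).
  have -> : ln s = 2^-1 * ln s + 2^-1 * ln s by field.
  by rewrite expRD -expr2 sqrtr_sqr ger0_norm ?expR_ge0//; congr expR; field.
case: ifP => _ /=.
  rewrite mul0r sub0r /besselY0 besselJ0_psum exprMn sqr_sqrtr ?ltW//.
  congr (- (4^-1 * (2 / pi * ((_ + _) * _ - _)))).
    rewrite mulrAC [LHS]lnM ?posrE ?divr_gt0 ?sqrtr_gt0//.
    by rewrite sqrtE expRK.
  congr (limn (series _)); apply/funext => m /=; rewrite /harmonic_coeff /bessel_coeff.
  rewrite half_expr_double [(k * _) ^+ 2]exprMn sqr_sqrtr ?ltW// [in RHS]invfM; move: (series harmonic m) => H.
  move: ((4 ^+ m)^-1 : R) ((m`!%:R ^+ 2)^-1 : R) ((-1) ^+ m : R) (_ ^+ m) => A B C D.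
  ring.
rewrite sqrtE expRN mul0r oppr0 mulr0 subr0 (expr0n _ 2) addr0; congr (_ * _).
have D0 : 4 * pi * expR (2^-1 * ln s) != 0.
  by rewrite !mulf_neq0// gt_eqF// ?pi_gt0 ?expR_gt0.
by rewrite expr2 invfM mulrA divff// mul1r invfM mulrC.
Qed.

Lemma Im_Phi_radial n (k : R) (x y : 'rV[R]_n) : 0 < k -> x != y ->
  complex.Im (Phi k x y) = im_radial n k (sqdist x y).
Proof. by move=> k0 xy; rewrite Im_Phi// imPhi_radial. Qed.

End green_function.
(** * Volume potentials away from their source *)

Section volume_potential.
Context (R : realType) (n : nat).
Implicit Types (x y z v : 'rV[R]_n) (K : set 'rV[R]_n).
Local Notation mu := (lebesgue_Rn R n).
Local Notation L := (caratheodory_type (@lebesgue_outer R n)).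

Lemma sqdistC x y : sqdist x y = sqdist y x.
Proof. by apply: eq_bigr => i _; rewrite -opprB sqrrN. Qed.

Lemma norm_sub_le_sqdist x y : `|x - y| ^+ 2 <= sqdist x y.
Proof.
rewrite -(sqr_sqrtr (sqdist_ge0 x y)) -enorm_sqdist lerXn2r ?nnegrE ?enorm_ge0//.
exact: norm_le_enorm.
Qed.

Lemma sqdist_le_norm_sub x y : sqdist x y <= (n%:R * `|x - y|) ^+ 2.
Proof.
rewrite -(sqr_sqrtr (sqdist_ge0 x y)) -enorm_sqdist lerXn2r ?nnegrE ?enorm_ge0 ?mulr_ge0//.
exact: enorm_le_norm.
Qed.

(** Near a point outside of the compact set [K], the distance to the points of [K]
    stays away from [0] and from infinity. *)
Lemma sqdist_bounds K x : compact K -> ~ K x -> exists r a b : R,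
  [/\ 0 < r, 0 < a, a <= b &
    forall x' y, `|x' - x| < r -> K y -> a <= sqdist x' y <= b].
Proof.
move=> cK Kx.
have oK : open (~` K) by exact/closed_openC/(compact_closed (@norm_hausdorff _ _) cK).
have /nbhs_normP[e /= e0 eK] := open_nbhs_nbhs (conj oK Kx).
have [M [_ /(_ (Num.max 1 (M + 1)))]] := compact_bounded cK.
rewrite lt_max ltrDl ltr01 orbT => /(_ isT) KM.
set M' := Num.max _ _ in KM.
pose b := (n%:R * (e + `|x| + M')) ^+ 2.
(* the minimum and the summand [1] ensure [0 < a <= b] even if [K] is empty *)
exists (e / 2), (Num.min ((e / 2) ^+ 2) (b + 1)), (b + 1); split.
- by rewrite divr_gt0.
- by rewrite lt_min exprn_gt0 ?divr_gt0// ltr_pwDr// sqr_ge0.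
- by rewrite ge_min lexx orbT.
move=> x' y xx' Ky; apply/andP; split.
  rewrite ge_min; apply/orP; left; apply: le_trans (norm_sub_le_sqdist _ _).
  have e2 : 0 < e / 2 by rewrite divr_gt0.
  rewrite lerXn2r ?nnegrE ?(ltW e2)//; rewrite leNgt; apply/negP => yx'.
  have := eK y; rewrite /ball_ /=; apply; last exact: Ky.
  rewrite -(subrKA x') (le_lt_trans (ler_normD _ _))// (splitr e) ltrD//.
  by rewrite distrC.
apply: le_trans (sqdist_le_norm_sub _ _) _; apply: ler_wpDr => //.
have e20 : e / 2 <= e by rewrite ler_pdivrMr// ler_peMr ?(ltW e0)// ler1n.
have M'0 : 0 <= M' by rewrite /M' le_max ler01.
rewrite lerXn2r ?nnegrE ?mulr_ge0 ?addr_ge0 ?(ltW e0)//.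
apply: ler_wpM2l => //; rewrite (le_trans (ler_normB _ _))// lerD//; last exact: KM.
rewrite -(subrK x x') (le_trans (ler_normD _ _))// lerD2r.
by rewrite (le_trans (ltW xx')).
Qed.

Context (K : set 'rV[R]_n) (f : 'rV[R]_n -> R) (G : R -> R).
Hypotheses (cK : compact K) (C1G : C1pos G).
Hypothesis intf : mu.-integrable K (EFin \o (f : L -> R)).

Definition potential x : R := \int[mu]_(y in K) (G (sqdist x y) * f y).

Let mK : measurable (K : set L).
Proof.
rewrite -[X in measurable X]setCK; apply: measurableC.
apply: (open_caratheodory (@lebesgue_half_space R n)).
exact/closed_openC/(compact_closed (@norm_hausdorff _ _) cK).
Qed.

Lemma measurable_radial x : ~ K x -> measurable_fun (K : set L) (fun y : L => G (sqdist x y)).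
Proof.
move=> Kx; pose V := [set y | 0 < sqdist x y].
have VE : V = (fun y => sqdist y x) @^-1` [set t | 0 < t].
  by apply/seteqP; split=> y; rewrite /V /= sqdistC.
have oV : open V.
  rewrite VE; apply: open_comp; last exact: open_gt.
  by move=> y _; exact: continuous_sqdist.
have -> : (fun y : L => G (sqdist x y)) = (fun y : L => G (sqdist y x)).
  by apply/funext => y; rewrite sqdistC.
apply: (@measurable_continuous_on R n _ (@lebesgue_half_space R n) _ V
  (fun y => G (sqdist y x)) mK oV).
  move=> y Ky; rewrite /V /= lt_neqAle sqdist_ge0 andbT eq_sym.
  apply/eqP => s0; apply: Kx; suff -> : x = y by [].
  apply/eqP; rewrite -subr_eq0 -normr_eq0 -sqrf_eq0 eq_le sqr_ge0 andbT -s0.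
  exact: norm_sub_le_sqdist.
move=> y Vy; apply: continuous_radial.
have [dG GP _] := C1G; have [] // := GP (sqdist y x) _.
by rewrite sqdistC.
Qed.

Lemma integrable_potential x : ~ K x ->
  mu.-integrable K (EFin \o ((fun y => G (sqdist x y) * f y) : L -> R)).
Proof.
move=> Kx; have [r [a [b [r0 a0 ab bnd]]]] := sqdist_bounds cK Kx.
have [M [M0 MP]] := C1pos_bounds C1G a0 ab; have [dG GP _] := C1G.
have := @integrableMl _ L R mu K mK _ (fun y => G (sqdist x y)) intf (measurable_radial Kx).
have GM : [bounded G (sqdist x y) | y in (K : set L)].
  exists M; split; first exact: num_real.
  move=> M' MM' y /= Ky; apply: le_trans (ltW MM').
  by have [] := MP dG GP (sqdist x y) (bnd x y _ Ky); rewrite ?subrr ?normr0.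
move=> /(_ GM); apply: eq_integrable => // y _ /=.
by rewrite -EFinM mulrC.
Qed.

(** The kernel is Lipschitz in [x] near a point outside of [K], uniformly in [y] in
    [K], and the source is integrable. *)
Lemma continuous_potential x : ~ K x -> {for x, continuous potential}.
Proof.
move=> Kx; have [r [a [b [r0 a0 ab bnd]]]] := sqdist_bounds cK Kx.
have [M [M0 MP]] := C1pos_bounds C1G a0 ab; have [dG GP _] := C1G.
have xr0 : `|x - x| < r by rewrite subrr normr0.
pose N : R := \int[mu]_(y in K) `|f y|.
have N0 : 0 <= N by exact: Rintegral_ge0.
have intN : mu.-integrable K (EFin \o (fun y : L => `|f y|)) by exact: integrable_norm.
pose D := n%:R * (Num.sqrt b + Num.sqrt b).
have D0 : 0 <= D by rewrite mulr_ge0// addr_ge0// sqrtr_ge0.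
have lip x' : `|x' - x| < r -> `|potential x' - potential x| <= M * D * N * `|x' - x|.
  move=> xx'; have Kx' : ~ K x'.
    move=> Kx'; have /andP[+ _] := bnd x' x' xx' Kx'.
    rewrite /sqdist big1 ?leNgt ?a0// => i _; by rewrite subrr expr0n.
  rewrite -RintegralB//; [|exact: integrable_potential|exact: integrable_potential].
  apply: le_trans (le_normr_Rintegral _ _) _ => //.
    by have := integrableB mK (integrable_potential Kx') (integrable_potential Kx).
  apply: (@le_trans _ _ (\int[mu]_(y in K) (M * D * `|x' - x| * `|f y|))).
    apply: le_Rintegral => //.
    - apply: integrable_norm => //.
      by have := integrableB mK (integrable_potential Kx') (integrable_potential Kx).
    - by apply: eq_integrable (integrableZl mK (M * D * `|x' - x|) intN) => // y _; rewrite /= EFinM.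
    move=> y Ky; rewrite -mulrBl normrM; apply: ler_wpM2r => //.
    have bx := bnd x y xr0 Ky; have bx' := bnd x' y xx' Ky.
    have [_ _ /(_ _ bx) Hlip] := MP dG GP _ bx'.
    apply: le_trans Hlip _; rewrite -mulrA; apply: ler_wpM2l => //.
    rewrite /sqdist -sumrB (le_trans (ler_norm_sum _ _ _))//.
    rewrite /D -mulrA mulr_natl -[X in _ *+ X]card_ord -sumr_const.
    apply: ler_sum => i _; rewrite subr_sqr normrM mulrC; apply: ler_pM => //.
      rewrite (le_trans (ler_normD _ _))// lerD//.
        apply: le_trans (_ : Num.sqrt (sqdist x' y) <= _).
          by have := le_abs_coord_enorm (x' - y) i; rewrite enorm_sqdist !mxE.
        by rewrite ler_wsqrtr//; case/andP: bx'.
      apply: le_trans (_ : Num.sqrt (sqdist x y) <= _).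
        by have := le_abs_coord_enorm (x - y) i; rewrite enorm_sqdist !mxE.
      by rewrite ler_wsqrtr//; case/andP: bx.
    have := le_abs_coord_norm (x' - x) i; rewrite !mxE; congr (_ <= _); congr `|_|; ring.
  by rewrite RintegralZl// mulrAC.
suff : forall e, 0 < e -> \forall x' \near x, `|potential x - potential x'| < e.
  by move/(@cvgrPdist_lt _ _ _ (nbhs x) (nbhs_filter x)).
move=> e e0; pose c := M * D * N + 1.
have c0 : 0 < c by rewrite ltr_pwDr// !mulr_ge0.
have : \forall x' \near x, `|x' - x| < Num.min r (e / c).
  apply/nbhs_normP; exists (Num.min r (e / c)) => /=; first by rewrite lt_min r0 divr_gt0.
  by move=> x' /=; rewrite distrC.
apply: filterS => x'; rewrite lt_min ltr_pdivlMr// => /andP[xr xe].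
rewrite distrC (le_lt_trans (lip x' xr))//; apply: le_lt_trans xe.
by rewrite mulrC ler_wpM2l// /c lerDl.
Qed.

(** Differentiation under the integral sign along the line through [x] with
    direction [v]; [e] is such that the points [h *: v + x] with [|h| < e] stay in
    the neighbourhood of [x] where the kernel and its derivative are bounded. *)
Lemma derivable_potential x v : ~ K x -> derivable potential x v.
Proof.
move=> Kx; have [r [a [b [r0 a0 ab bnd]]]] := sqdist_bounds cK Kx.
have [M [M0 MP]] := C1pos_bounds C1G a0 ab; have [dG GP _] := C1G.
pose e := r / (`|v| + 1).
have e0 : 0 < e by rewrite divr_gt0// ltr_wpDl.
pose F (h : R) (y : L) := G (sqdist (h *: v + x) y) * f y.
have near_x (h : R) : `]-e, e[%classic h -> `|h *: v + x - x| < r.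
  rewrite /= in_itv /= -ltr_norml addrK normrZ => he.
  apply: (@le_lt_trans _ _ (`|h| * (`|v| + 1))); first by rewrite ler_wpM2l// lerDl.
  by rewrite -ltr_pdivlMr// ltr_wpDl.
have notK (h : R) : `]-e, e[%classic h -> ~ K (h *: v + x).
  move=> /near_x xx' Kx'; have /andP[+ _] := bnd _ _ xx' Kx'.
  rewrite {1}/sqdist big1 ?leNgt ?a0// => i _; by rewrite subrr expr0n.
have dF (h : R) y : `]-e, e[%classic h -> K y -> is_derive h 1 (F^~ y)
    (f y * (dG (sqdist (h *: v + x) y) *
      (2 * \sum_(i < n) v 0 i * ((h *: v + x) 0 i - y 0 i)))).
  move=> /near_x hI Ky; have /andP[s0 _] := bnd _ _ hI Ky.
  have HG := GP _ (lt_le_trans a0 s0).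
  have H := @is_derive_radial_line R n G _ h x y v HG.
  rewrite /F; apply: is_derive_eq; rewrite /GRing.scale /=; ring.
have I0 : `]-e, e[%classic (0 : R) by rewrite /= in_itv /= oppr_lt0 e0.
pose B := M * (2 * (n%:R * (`|v| * Num.sqrt b))).
have B0 : 0 <= B by rewrite !mulr_ge0// sqrtr_ge0.
have intB : mu.-integrable K (EFin \o (fun y : L => B * `|f y|)).
  have intN : mu.-integrable K (EFin \o (fun y : L => `|f y|)) by exact: integrable_norm.
  by apply: eq_integrable (integrableZl mK B intN) => // y _; rewrite /= EFinM.
have Fub (h : R) (y : L) : `]-e, e[%classic h -> K y -> `|partial1of2 F h y| <= B * `|f y|.
  move=> hI Ky; rewrite partial1of2E; have [_ ->] := dF h y hI Ky.
  rewrite normrM mulrC; apply: ler_wpM2r => //; rewrite normrM.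
  have by_ := bnd _ _ (near_x h hI) Ky.
  have [_ dGM _] := MP dG GP _ by_; apply: ler_pM => //.
  rewrite normrM (@ger0_norm _ 2)//; apply: ler_wpM2l => //.
  rewrite (le_trans (ler_norm_sum _ _ _))//.
  rewrite mulr_natl -[X in _ *+ X]card_ord -sumr_const.
  apply: ler_sum => i _; rewrite normrM; apply: ler_pM => //.
    exact: le_abs_coord_norm.
  apply: le_trans (_ : Num.sqrt (sqdist (h *: v + x) y) <= _).
    by have := le_abs_coord_enorm (h *: v + x - y) i; rewrite enorm_sqdist !mxE.
  by rewrite ler_wsqrtr//; case/andP: by_.
have := @derivable_under_integral R _ L mu F K mK 0 (- e) e I0
  (fun h hI => integrable_potential (notK h hI))
  (fun h y hI Ky => @ex_derive _ _ _ _ _ _ _ (dF h y hI Ky))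
  (fun y => B * `|f y|) (fun y => mulr_ge0 B0 (normr_ge0 _)) intB Fub.
move=> /derivableP dpot.
have := @is_derive_line R n potential x v _ dpot.
by case.
Qed.

End volume_potential.
(** * Integral estimates *)

Section lebesgue_finite.
Context (R : realType) (n : nat).
Local Open Scope ereal_scope.

Lemma cover_outer_le_gauge (T : pointedType) (tau : set T -> \bar R) (A : set T) :
  tau set0 = 0 -> (forall B, 0 <= tau B) -> cover_outer tau A <= tau A.
Proof.
move=> tau0 tau_ge0; pose F (k : nat) : set T := if k == 0%N then A else set0.
apply: ge_ereal_inf; exists (\sum_(k <oo) tau (F k)).
  by exists F => //= x Ax; exists 0%N.
rewrite (nneseries_split _ 1)//= big_nat1 eseries0 ?adde0//.
by move=> [|k]//= _ _; rewrite /F.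
Qed.

Lemma lebesgue_compact_finite (K : set 'rV[R]_n) : compact K -> lebesgue_outer K < +oo.
Proof.
move=> cK; have [M [_ /(_ (M + 1)%R)]] := compact_bounded cK.
rewrite ltrDl ltr01 => /(_ isT) KM.
apply: le_lt_trans (cover_outer_le_gauge K (box_gauge0 _ _) (@box_gauge_ge0 R n)) _.
rewrite /box_gauge; case: asboolP => [_|_]; first exact: ltry.
pose b : 'rV[R]_n := const_mx (M + 1)%R.
apply: (@le_lt_trans _ _ (\prod_(i < n) (b 0 i - (- b) 0 i)%R)%:E); last exact: ltry.
apply: ge_ereal_inf; exists (\prod_(i < n) (b 0 i - (- b) 0 i)%R)%:E => //.
exists (- b, b)%R => //= x /KM xM i; rewrite !mxE -ler_norml.
by apply: le_trans xM; exact: le_abs_coord_norm.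
Qed.

End lebesgue_finite.

Section complex_numbers.
Context (R : realType).

Lemma normc_le (p q : R) : Normc.normc (p +i* q)%C <= `|p| + `|q|.
Proof.
rewrite /= -[leRHS]ger0_norm ?addr_ge0// -sqrtr_sqr ler_sqrt ?sqr_ge0//.
rewrite sqrrD !real_normK ?num_real// addrAC lerDl.
by rewrite mulrn_wge0// mulr_ge0.
Qed.

Lemma abs_Re_le_normc (z : R[i]) : `|complex.Re z| <= Normc.normc z.
Proof. by case: z => p q /=; rewrite -sqrtr_sqr ler_sqrt ?addr_ge0 ?sqr_ge0// lerDl sqr_ge0. Qed.

Lemma abs_Im_le_normc (z : R[i]) : `|complex.Im z| <= Normc.normc z.
Proof. by case: z => p q /=; rewrite -sqrtr_sqr ler_sqrt ?addr_ge0 ?sqr_ge0// lerDr sqr_ge0. Qed.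

Lemma ReB (z w : R[i]) : complex.Re (z - w) = complex.Re z - complex.Re w.
Proof. by case: z w => [? ?] [? ?]. Qed.

Lemma ImB (z w : R[i]) : complex.Im (z - w) = complex.Im z - complex.Im w.
Proof. by case: z w => [? ?] [? ?]. Qed.

End complex_numbers.

Section integrals.
Context (R : realType) d (T : measurableType d) (mu : {measure set T -> \bar R}).
Implicit Types (D K : set T).

Lemma ae_imply (P Q : T -> Prop) : (forall x, P x -> Q x) ->
  {ae mu, forall x, P x} -> {ae mu, forall x, Q x}.
Proof. by move=> PQ; apply: filterS. Qed.

(** The integrand is only known to be measurable on [K]; completeness of the measure
    makes it measurable on [D], since it vanishes almost everywhere off [K]. *)
Lemma Rintegral_ae_supported D K (f h : T -> R) : measure_is_complete mu ->
  measurable D -> measurable K -> K `<=` D -> measurable_fun K h ->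
  {ae mu, forall x, ~ K x -> f x = 0} -> (forall x, f x = 0 -> h x = 0) ->
  \int[mu]_(x in D) h x = \int[mu]_(x in K) h x.
Proof.
move=> cmu mD mK KD mh f0 fh; rewrite /Rintegral; congr fine.
have DK : D `&` K = K by exact/setIidPr.
rewrite -[in RHS]DK integral_mkcondr.
have mhK : measurable_fun D ((EFin \o h) \_ K).
  apply/(measurable_restrict _ _ _).1 => //; rewrite DK.
  exact/measurable_EFinP.
have aeE : ae_eq mu D ((EFin \o h) \_ K) (EFin \o h).
  apply: filterS f0 => x fx Dx; rewrite /patch; case: ifPn => // /negP xK.
  by rewrite /= fh// fx// => Kx; apply: xK; rewrite inE.
apply: ae_eq_integral => //; first exact: (ae_measurable_fun cmu aeE).
exact: ae_eq_sym.
Qed.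

(** The arithmetic-geometric inequality [2 * |w| <= delta + |w| ^+ 2 / delta]
    turns an [L^2] bound into an [L^1] bound on a set of finite measure. *)
Lemma L1_of_L2norm D (g : T -> R[i]) (w : T -> R) (delta : R) :
  measurable D -> (mu D < +oo)%E -> 0 < delta ->
  measurable_fun D (fun x => complex.Re (g x)) ->
  measurable_fun D (fun x => complex.Im (g x)) ->
  measurable_fun D w -> (forall x, `|w x| <= Normc.normc (g x)) ->
  (L2norm mu D g <= delta%:E)%E ->
  mu.-integrable D (EFin \o w) /\
  \int[mu]_(x in D) `|w x| <= delta * (fine (mu D) + 1).
Proof.
move=> mD Doo delta0 mRe mIm mw wg gd.
have mg2 : measurable_fun D (fun x => Normc.normc (g x) ^+ 2).
  apply: (eq_measurable_fun (fun x => complex.Re (g x) ^+ 2 + complex.Im (g x) ^+ 2)).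
    move=> x _; rewrite /Normc.normc; case: (g x) => a b /=.
    by rewrite sqr_sqrtr// addr_ge0 ?sqr_ge0.
  by apply: measurable_funD; exact: measurable_funX.
have ig2 : (\int[mu]_(x in D) (Normc.normc (g x) ^+ 2)%:E <= (delta ^+ 2)%:E)%E.
  have : (L2norm mu D g `^ 2 <= delta%:E `^ 2)%E.
    by rewrite gt0_ler_poweR// ?in_itv/= ?leey ?Lnorm_ge0// lee_fin ltW.
  rewrite /L2norm unlock -poweRrM mulVf// poweRe1; last first.
    by apply: integral_ge0 => x _; exact: poweR_ge0.
  rewrite poweR_EFin powR_mulrn ?(ltW delta0)//; apply: le_trans.
  rewrite le_eqVlt; apply/orP; left; apply/eqP.
  rewrite integral_mkcond; apply: eq_integral => x _; rewrite /patch.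
  case: ifPn => _; last by rewrite -[point]/(0%E : \bar R) abse0 poweR0r// pnatr_eq0.
  by rewrite abse_EFin poweR_EFin powR_mulrn// real_normK// num_real.
have bnd x : `|w x| <= delta + delta^-1 * Normc.normc (g x) ^+ 2.
  apply: le_trans (wg x) _; move: (Normc.normc (g x)) => t.
  have : 0 <= (t / delta - 2^-1) ^+ 2 by exact: sqr_ge0.
  rewrite -(@ler_pM2l _ delta)// mulr0.
  have -> : delta * (t / delta - 2^-1) ^+ 2 = delta^-1 * t ^+ 2 - t + 4^-1 * delta.
    by field; rewrite gt_eqF.
  move: delta0; lra.
have intg2 : mu.-integrable D (EFin \o (fun x => Normc.normc (g x) ^+ 2)).
  apply/integrableP; split; first exact/measurable_EFinP.
  apply: le_lt_trans (ltry (delta ^+ 2)); apply: le_trans ig2.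
  rewrite le_eqVlt; apply/orP; left; apply/eqP; apply: eq_integral => x _ /=.
  by rewrite ger0_norm// sqr_ge0.
have i1 : mu.-integrable D (EFin \o (fun=> delta)).
  by apply: measurable_bounded_integrable => //; exists delta; split=> [|M /ltW dM x _];
    rewrite ?num_real//= ger0_norm// ltW.
have i2 : mu.-integrable D (EFin \o (fun x => delta^-1 * Normc.normc (g x) ^+ 2)).
  have := integrableZl mD delta^-1 intg2.
  by apply: eq_integrable => // x _; rewrite /= EFinM.
have intB : mu.-integrable D
    (EFin \o (fun x => delta + delta^-1 * Normc.normc (g x) ^+ 2)).
  by have := integrableD mD i1 i2.
have intw : mu.-integrable D (EFin \o w).
  apply: le_integrable intB => //; first exact/measurable_EFinP.
  by move=> x _ /=; rewrite lee_fin (le_trans (bnd x))// ler_norm.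
split=> //; apply: le_trans (le_Rintegral mD (integrable_norm intw) intB (fun x _ => bnd x)) _.
rewrite RintegralD//.
rewrite Rintegral_cst// RintegralZl// mulrDr mulr1 lerD//.
rewrite ler_pdivrMl// -expr2 /Rintegral.
rewrite -lee_fin fineK// ge0_fin_numE; first by rewrite (le_lt_trans ig2)// ltry.
by apply: integral_ge0 => x _; rewrite lee_fin sqr_ge0.
Qed.

Lemma L2_integrable D (g : T -> R[i]) : measurable D -> (mu D < +oo)%E -> L2 mu D g ->
  mu.-integrable D (EFin \o (fun x => complex.Re (g x))) /\
  mu.-integrable D (EFin \o (fun x => complex.Im (g x))).
Proof.
move=> mD Doo [mR mI goo]; have g0 : (0 <= L2norm mu D g)%E by exact: Lnorm_ge0.
pose e := fine (L2norm mu D g) + 1.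
have e0 : 0 < e by rewrite ltr_wpDl// fine_ge0.
have ge : (L2norm mu D g <= e%:E)%E.
  by rewrite /e EFinD fineK ?ge0_fin_numE// leeDl// lee_fin.
have [iR _] := L1_of_L2norm mD Doo e0 mR mI mR (fun x => abs_Re_le_normc (g x)) ge.
have [iI _] := L1_of_L2norm mD Doo e0 mR mI mI (fun x => abs_Im_le_normc (g x)) ge.
by [].
Qed.

Lemma L1_of_L2norm_sub D (g h : T -> R[i]) (delta : R) :
  measurable D -> (mu D < +oo)%E -> 0 < delta ->
  measurable_fun D (fun x => complex.Re (g x)) ->
  measurable_fun D (fun x => complex.Im (g x)) ->
  measurable_fun D (fun x => complex.Re (h x)) ->
  measurable_fun D (fun x => complex.Im (h x)) ->
  (L2norm mu D (fun x => g x - h x)%R <= delta%:E)%E ->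
  (mu.-integrable D (EFin \o (fun x => complex.Re (g x) - complex.Re (h x))) /\
   \int[mu]_(x in D) `|complex.Re (g x) - complex.Re (h x)| <= delta * (fine (mu D) + 1)) /\
  (mu.-integrable D (EFin \o (fun x => complex.Im (g x) - complex.Im (h x))) /\
   \int[mu]_(x in D) `|complex.Im (g x) - complex.Im (h x)| <= delta * (fine (mu D) + 1)).
Proof.
move=> mD Doo delta0 mRg mIg mRh mIh gh.
have mR := measurable_funB mRg mRh; have mI := measurable_funB mIg mIh.
have mRB : measurable_fun D (fun x => complex.Re (g x - h x)).
  by apply: eq_measurable_fun mR => x _; rewrite ReB.
have mIB : measurable_fun D (fun x => complex.Im (g x - h x)).
  by apply: eq_measurable_fun mI => x _; rewrite ImB.
split; apply: (L1_of_L2norm mD Doo delta0 mRB mIB) => //.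
- by move=> x; rewrite -ReB; exact: abs_Re_le_normc.
- by move=> x; rewrite -ImB; exact: abs_Im_le_normc.
Qed.

Lemma norm_Rintegral_pairing_le D (a b w w' : T -> R) (A B : R) :
  measurable D -> measurable_fun D a -> measurable_fun D b ->
  (forall x, D x -> `|a x| <= A) -> (forall x, D x -> `|b x| <= B) ->
  mu.-integrable D (EFin \o w) -> mu.-integrable D (EFin \o w') ->
  mu.-integrable D (EFin \o (fun x => a x * w x - b x * w' x)) /\
  `|\int[mu]_(x in D) (a x * w x - b x * w' x)| <=
    A * \int[mu]_(x in D) `|w x| + B * \int[mu]_(x in D) `|w' x|.
Proof.
move=> mD ma mb aA bB iw iw'.
have mul_int (c v : T -> R) (C : R) : measurable_fun D c ->
    (forall x, D x -> `|c x| <= C) -> mu.-integrable D (EFin \o v) ->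
    mu.-integrable D (EFin \o (fun x => c x * v x)).
  move=> mc cC iv; have bc : [bounded c x | x in D].
    by exists C; split=> [|M /ltW CM x Dx]; rewrite ?num_real//= (le_trans (cC x Dx)).
  have := integrableMl mD iv mc bc.
  by apply: eq_integrable => // x _; rewrite /= -EFinM mulrC.
have iaw := mul_int a w A ma aA iw; have ibw := mul_int b w' B mb bB iw'.
have iabw : mu.-integrable D (EFin \o (fun x => a x * w x - b x * w' x)).
  by have := integrableB mD iaw ibw.
split=> //; apply: le_trans (le_normr_Rintegral mD iabw) _.
have scal (C : R) (v : T -> R) : mu.-integrable D (EFin \o v) ->
    mu.-integrable D (EFin \o (fun x => C * `|v x|)).
  move=> iv; have := integrableZl mD C (integrable_norm iv).
  by apply: eq_integrable => // x _; rewrite /= EFinM.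
rewrite -!RintegralZl ?integrable_norm// -RintegralD//; try exact: scal.
apply: le_Rintegral => //; first exact: integrable_norm.
  by have := integrableD mD (scal A w iw) (scal B w' iw').
move=> x Dx; rewrite (le_trans (ler_normB _ _))// !normrM lerD// ler_wpM2r//.
- exact: aA.
- exact: bB.
Qed.

Lemma ae_eq_Rintegral D (f g : T -> R) : measure_is_complete mu -> measurable D ->
  {ae mu, forall x, D x -> f x = g x} -> mu.-integrable D (EFin \o f) ->
  mu.-integrable D (EFin \o g) /\ \int[mu]_(x in D) f x = \int[mu]_(x in D) g x.
Proof.
move=> cmu mD fg intf; have mf := measurable_int mu intf.
have aeE : ae_eq mu D (EFin \o f) (EFin \o g).
  by apply: filterS fg => x H Dx; rewrite /= H.
have mg : measurable_fun D (EFin \o g) by exact: (ae_measurable_fun cmu aeE mf).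
split; last by rewrite /Rintegral; congr fine; exact: ae_eq_integral.
apply/integrableP; split=> //.
have /integrableP[_] := intf; congr (_ < _)%E; apply: ge0_ae_eq_integral => //.
- exact: measurableT_comp.
- exact: measurableT_comp.
- exact: ae_eq_abse.
Qed.

(** The factor [a] stands for a normal derivative, which is bounded only where the
    normal is a unit vector, that is almost everywhere. *)
Lemma norm_Rintegral_pairing_ae_le D (a b w w' : T -> R) (A B : R) :
  measure_is_complete mu -> measurable D -> measurable_fun D a -> measurable_fun D b ->
  0 <= A -> {ae mu, forall x, D x -> `|a x| <= A} -> (forall x, D x -> `|b x| <= B) ->
  mu.-integrable D (EFin \o w) -> mu.-integrable D (EFin \o w') ->
  mu.-integrable D (EFin \o (fun x => a x * w x - b x * w' x)) /\
  `|\int[mu]_(x in D) (a x * w x - b x * w' x)| <=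
    A * \int[mu]_(x in D) `|w x| + B * \int[mu]_(x in D) `|w' x|.
Proof.
move=> cmu mD ma mb A0 aA bB iw iw'.
pose a' x := if `|a x| <= A then a x else 0.
have aa' : {ae mu, forall x, D x -> a x = a' x}.
  by apply: filterS aA => x H Dx; rewrite /a' H.
have ma' : measurable_fun D a'.
  have aeE : ae_eq mu D (EFin \o a) (EFin \o a').
    by apply: filterS aa' => x H Dx; rewrite /= H.
  by apply/measurable_EFinP/(ae_measurable_fun cmu aeE)/measurable_EFinP.
have a'A x : D x -> `|a' x| <= A.
  by move=> _; rewrite /a'; case: ifPn => // _; rewrite normr0.
have [i' bound] := norm_Rintegral_pairing_le mD ma' mb a'A bB iw iw'.
have eqint : {ae mu, forall x, D x -> a' x * w x - b x * w' x = a x * w x - b x * w' x}.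
  by apply: filterS aa' => x H Dx; rewrite H.
by have [? <-] := ae_eq_Rintegral cmu mD eqint i'.
Qed.

(** Integrability of [g] and [h] follows from that of [g'] and [h'] and of the
    differences. *)
Lemma norm_Rintegral_pairing_sub_le D (a b g g' h h' : T -> R) (A B C : R) :
  measure_is_complete mu -> measurable D -> measurable_fun D a -> measurable_fun D b ->
  0 <= A -> 0 <= B ->
  {ae mu, forall x, D x -> `|a x| <= A} -> (forall x, D x -> `|b x| <= B) ->
  mu.-integrable D (EFin \o g') -> mu.-integrable D (EFin \o h') ->
  mu.-integrable D (EFin \o (fun x => g x - g' x)) ->
  mu.-integrable D (EFin \o (fun x => h x - h' x)) ->
  \int[mu]_(x in D) `|g x - g' x| <= C -> \int[mu]_(x in D) `|h x - h' x| <= C ->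
  `|\int[mu]_(x in D) (a x * g x - b x * h x) -
    \int[mu]_(x in D) (a x * g' x - b x * h' x)| <= (A + B) * C.
Proof.
move=> cmu mD ma mb A0 B0 aA bB ig' ih' igg ihh gC hC.
have sub_int (v v' : T -> R) : mu.-integrable D (EFin \o v') ->
    mu.-integrable D (EFin \o (fun x => v x - v' x)) -> mu.-integrable D (EFin \o v).
  move=> i1 i2; have := integrableD mD i2 i1.
  by apply: eq_integrable => // x _; rewrite /= -EFinD subrK.
have [i1 _] := norm_Rintegral_pairing_ae_le cmu mD ma mb A0 aA bB
  (sub_int _ _ ig' igg) (sub_int _ _ ih' ihh).
have [i2 _] := norm_Rintegral_pairing_ae_le cmu mD ma mb A0 aA bB ig' ih'.
have [_ bound] := norm_Rintegral_pairing_ae_le cmu mD ma mb A0 aA bB igg ihh.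
rewrite -RintegralB//.
have -> : \int[mu]_(x in D) (a x * g x - b x * h x - (a x * g' x - b x * h' x)) =
    \int[mu]_(x in D) (a x * (g x - g' x) - b x * (h x - h' x)).
  by apply: eq_Rintegral => x _; ring.
by apply: le_trans bound _; rewrite mulrDl lerD// ler_wpM2l.
Qed.

End integrals.
(** * The wave on the boundary *)

Section unit_normal.
Context (R : realType) (d : nat).

(** The graph normal is nonzero because its last component is [-1], and the chart
    coordinates are orthogonal. *)
Lemma outward_normal_unit (Omega : set 'rV[R]_d.+1) p v :
  outward_normal_at Omega p v -> enorm v = 1.
Proof.
move=> [r [Q [phi [[_ QQ _ _] _ vQ]]]].
rewrite -(enorm_mul_orthogonal v QQ) vQ.
set g := graph_normal phi _.
have g0 : enorm g != 0.
  rewrite enorm_eq0; apply/eqP => /rowP/(_ ord_max); rewrite !mxE unlift_none.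
  by move/eqP; rewrite oppr_eq0 oner_eq0.
rewrite {1}/enorm; under eq_bigr do rewrite mxE exprMn.
rewrite -mulr_sumr -sqr_enorm -exprMn mulVf// expr1n sqrtr1 //.
Qed.

End unit_normal.

Section wave_regularity.
Context (R : realType) (d : nat) (Omega K : set 'rV[R]_d.+1) (f : 'rV[R]_d.+1 -> R) (k : R).
Local Notation mu := (lebesgue_Rn R d.+1).
Local Notation L := (caratheodory_type (@lebesgue_outer R d.+1)).
Hypotheses (k_gt0 : 0 < k) (oOmega : open Omega).
Hypothesis f_L2 : (f : L -> R) \in Lfun mu 2%:E.
Hypotheses (cK : compact K) (KOmega : K `<=` Omega).
Hypothesis f_supp : {ae mu, forall y, ~ K y -> f y = 0}.

Let closedK : closed K.
Proof. exact: (compact_closed (@norm_hausdorff _ _) cK). Qed.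

Let mK : measurable (K : set L).
Proof.
rewrite -[X in measurable X]setCK; apply: measurableC.
by apply: (open_caratheodory (@lebesgue_half_space R d.+1)); exact: closed_openC.
Qed.

Let mOmega : measurable (Omega : set L).
Proof. exact: (open_caratheodory (@lebesgue_half_space R d.+1)). Qed.

Let mf : measurable_fun [set: L] (f : L -> R).
Proof. by move: f_L2; rewrite inE => /andP[]; rewrite inE. Qed.

(** [|f| <= 1 + f ^+ 2], and [K] has finite measure. *)
Lemma integrable_source : mu.-integrable K (EFin \o (f : L -> R)).
Proof.
have i2 : mu.-integrable K (EFin \o (fun y : L => f y ^+ 2)).
  exact: (integrableS measurableT mK (@subsetT _ _) (Lfun2_integrable_sqr f_L2)).
have i1 : mu.-integrable K (EFin \o (fun=> 1 : R)).
  apply: measurable_bounded_integrable => //; first exact: lebesgue_compact_finite.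
  by exists 1; split=> [|M /ltW M1 x _]; rewrite ?num_real//= normr1.
have i12 : mu.-integrable K (EFin \o (fun y : L => 1 + f y ^+ 2)).
  by have := integrableD mK i1 i2.
apply: le_integrable i12 => //.
  by apply/measurable_EFinP; exact: measurable_funS mf.
move=> y _ /=; rewrite lee_fin [leRHS]ger0_norm ?addr_ge0 ?sqr_ge0//.
have := sqr_ge0 (`|f y| - 2^-1); rewrite -(real_normK (num_real (f y))).
set t := `|f y|; nra.
Qed.

Lemma wave_Re x : ~ K x ->
  complex.Re (wave Omega k f x) = potential K f (re_radial d.+1 k) x.
Proof.
move=> Kx; pose h (y : L) : R := complex.Re (Phi k x y * (f y)%:C%C).
have hE : {in (K : set L), h =1 (fun y => re_radial d.+1 k (sqdist x y) * f y)}.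
  move=> y /set_mem Ky; rewrite -Re_Phi//; last by apply/eqP => xy; apply: Kx; rewrite xy.
  by rewrite /h; case: (Phi k x y) => a b /=; rewrite mulr0 subr0.
have h0 y : f y = 0 -> h y = 0.
  by move=> fy; rewrite /h fy; case: (Phi k x y) => a b /=; rewrite !mulr0 subr0.
have mh : measurable_fun (K : set L) h.
  apply: (eq_measurable_fun (fun y : L => re_radial d.+1 k (sqdist x y) * f y)).
    by move=> y yK; rewrite hE.
  apply: measurable_funM; last exact: measurable_funS mf.
  exact: (measurable_radial cK (C1pos_re_radial _ _)).
have E := @Rintegral_ae_supported R _ L mu Omega K f h
  (@measure_is_complete_caratheodory _ _ _) mOmega mK KOmega mh f_supp h0.
apply: (etrans E); exact: eq_Rintegral.
Qed.

Lemma wave_Im x : ~ K x ->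
  complex.Im (wave Omega k f x) = potential K f (im_radial d.+1 k) x.
Proof.
move=> Kx; pose h (y : L) : R := complex.Im (Phi k x y * (f y)%:C%C).
have hE : {in (K : set L), h =1 (fun y => im_radial d.+1 k (sqdist x y) * f y)}.
  move=> y /set_mem Ky; rewrite -Im_Phi_radial//; last by apply/eqP => xy; apply: Kx; rewrite xy.
  by rewrite /h; case: (Phi k x y) => a b /=; rewrite mulr0 add0r.
have h0 y : f y = 0 -> h y = 0.
  by move=> fy; rewrite /h fy; case: (Phi k x y) => a b /=; rewrite !mulr0 add0r.
have mh : measurable_fun (K : set L) h.
  apply: (eq_measurable_fun (fun y : L => im_radial d.+1 k (sqdist x y) * f y)).
    by move=> y yK; rewrite hE.
  apply: measurable_funM; last exact: measurable_funS mf.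
  exact: (measurable_radial cK (C1pos_im_radial _ _)).
have E := @Rintegral_ae_supported R _ L mu Omega K f h
  (@measure_is_complete_caratheodory _ _ _) mOmega mK KOmega mh f_supp h0.
apply: (etrans E); exact: eq_Rintegral.
Qed.

End wave_regularity.

Section boundary_measurability.
Context (R : realType) (d : nat) (F : set 'rV[R]_d.+1) (nu : 'rV[R]_d.+1 -> 'rV[R]_d.+1).
Local Notation S := (caratheodory_type (@hausdorff_outer R d.+1 d)).
Hypothesis mF : measurable (F : set S).
Hypothesis mnu : forall i, measurable_fun (F : set S) (fun x : S => nu x 0 i).

Lemma measurable_boundary_derivative (V : set 'rV[R]_d.+1) (w : 'rV[R]_d.+1 -> R) :
  open V -> F `<=` V -> (forall x, V x -> {for x, continuous w}) ->
  (forall x v, V x -> derivable w x v) ->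
  measurable_fun (F : set S) (fun x : S => 'D_(nu x) w x).
Proof.
move=> oV FV cw dw.
have mX i : measurable_fun (F : set S) (fun x : S => (x : 'rV[R]_d.+1) 0 i).
  exact: (measurable_coord (@hausdorff_half_space R d.+1 d)).
exact: (@measurable_directional_derivative R d.+1 _ S F (fun x => x) nu V w
  mF mX mnu oV FV cw (fun x Fx => dw x (nu x) (FV x Fx))).
Qed.

(** The wave [w] coincides with a potential [p] only off [K]; this suffices because
    derivatives at a point of [F] depend on a neighbourhood of that point. *)
Lemma measurable_boundary_wave (K : set 'rV[R]_d.+1) (w p : 'rV[R]_d.+1 -> R) :
  closed K -> (forall x, F x -> ~ K x) -> (forall x, ~ K x -> w x = p x) ->
  (forall x, ~ K x -> {for x, continuous p}) ->
  (forall x v, ~ K x -> derivable p x v) ->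
  measurable_fun (F : set S) (fun x : S => w x) /\
  measurable_fun (F : set S) (fun x : S => 'D_(nu x) w x).
Proof.
move=> clK FK wp cp dp; have oV := closed_openC clK; split.
  apply: (eq_measurable_fun (fun x : S => p x)) => [x /set_mem Fx|].
    by rewrite wp//; exact: FK.
  exact: (measurable_continuous_on (@hausdorff_half_space R d.+1 d) mF oV).
apply: (eq_measurable_fun (fun x : S => 'D_(nu x) p x)) => [x /set_mem Fx|].
  apply: near_eq_derive; have : nbhs (x : 'rV[R]_d.+1) (~` K).
    by apply: open_nbhs_nbhs; split=> //; exact: FK.
  by apply: filterS => y /wp.
exact: (measurable_boundary_derivative oV).
Qed.

End boundary_measurability.
(** * Stability of the imaging function *)

Lemma imagingE (R : realType) d (Omega : set 'rV[R]_d.+1) nu (k : R) g h z :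
  imaging Omega nu k g h z =
  (\int[surface R d]_(x in frontier Omega)
     ('D_(nu x) (fun y => imPhi k y z) x * complex.Re (g x) - imPhi k x z * complex.Re (h x))
   +i* \int[surface R d]_(x in frontier Omega)
     ('D_(nu x) (fun y => imPhi k y z) x * complex.Im (g x) - imPhi k x z * complex.Im (h x)))%C.
Proof.
have ndE x : normal_derivative nu (fun y => (imPhi k y z)%:C%C) x =
    ('D_(nu x) (fun y => imPhi k y z) x)%:C%C.
  by rewrite /normal_derivative /cderive /= derive_cst.
rewrite /imaging /cintegral; congr (_ +i* _)%C; apply: eq_Rintegral => x _; rewrite ndE.
  by rewrite ReB; case: (g x) (h x) => [? ?] [? ?] /=; rewrite !mul0r !subr0.
by rewrite ImB; case: (g x) (h x) => [? ?] [? ?] /=; rewrite !mul0r !addr0.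
Qed.

Lemma imaging_stability (R : realType) (d : nat)
    (Omega : set 'rV[R]_d.+1) (nu : 'rV[R]_d.+1 -> 'rV[R]_d.+1) (k : R)
    (g h : 'rV[R]_d.+1 -> R[i]) :
  d.+1 = 2%N \/ d.+1 = 3%N -> bounded_lipschitz_domain Omega ->
  outward_unit_normal Omega nu -> 0 < k ->
  let mu := surface R d in
  let F : set (caratheodory_type (@hausdorff_outer R d.+1 d)) := frontier Omega in
  measurable_fun F (fun x => complex.Re (g x)) ->
  measurable_fun F (fun x => complex.Im (g x)) ->
  measurable_fun F (fun x => complex.Re (h x)) ->
  measurable_fun F (fun x => complex.Im (h x)) ->
  exists2 C : R, 0 < C & forall (delta : R) (g_ h_ : 'rV[R]_d.+1 -> R[i]), 0 < delta ->
    L2 mu F g_ -> L2 mu F h_ ->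
    (L2norm mu F (fun x => (g x - g_ x)%R) <= delta%:E)%E ->
    (L2norm mu F (fun x => (h x - h_ x)%R) <= delta%:E)%E ->
    forall z, Normc.normc (imaging Omega nu k g h z - imaging Omega nu k g_ h_ z) <= C * delta.
Proof.
move=> n23 Omega_lip nu_normal k_gt0 mu F mRe mIm mdRe mdIm.
have [mnu ae_normal] := nu_normal.
pose S := caratheodory_type (@hausdorff_outer R d.+1 d).
have mF : measurable (F : set S).
  exact: (frontier_caratheodory (@hausdorff_half_space R d.+1 d)).
have Foo : (mu F < +oo)%E by exact: hausdorff_frontier_finite.
have cmu : measure_is_complete mu by exact: measure_is_complete_caratheodory.
pose B := im_factor d.+1 k; pose A := d.+1%:R * B * k.
have B0 : 0 <= B by exact: im_factor_ge0.
have A0 : 0 <= A by rewrite !mulr_ge0// ltW.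
pose m := fine (mu F) + 1.
have m1 : 1 <= m by rewrite /m lerDr fine_ge0// measure_ge0.
(* [2] accounts for the real and imaginary parts, [m] for the passage from [L^2]
   to [L^1], and [1] makes the constant positive *)
exists (2 * (A + B) * m + 1); first by rewrite ltr_pwDr// !mulr_ge0 ?addr_ge0// (le_trans ler01).
move=> delta g_ h_ delta0 [mRe_ mIm_ g_oo] [mdRe_ mdIm_ h_oo] g_le h_le z.
have [ig_R ig_I] := @L2_integrable R _ S mu F g_ mF Foo (And3 mRe_ mIm_ g_oo).
have [ih_R ih_I] := @L2_integrable R _ S mu F h_ mF Foo (And3 mdRe_ mdIm_ h_oo).
have [[igR gR] [igI gI]] :=
  @L1_of_L2norm_sub R _ S mu F g g_ delta mF Foo delta0 mRe mIm mRe_ mIm_ g_le.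
have [[ihR hR] [ihI hI]] :=
  @L1_of_L2norm_sub R _ S mu F h h_ delta mF Foo delta0 mdRe mdIm mdRe_ mdIm_ h_le.
pose a (x : S) := 'D_(nu x) (fun y => imPhi k y z) x.
have ma : measurable_fun (F : set S) a.
  apply: (measurable_boundary_derivative mF mnu openT) => //.
    by move=> x _; exact: continuous_imPhi.
  by move=> x v _; have [] := is_derive_imPhi k x z v.
have mb : measurable_fun (F : set S) (fun x : S => imPhi k x z).
  apply: (measurable_continuous_on (@hausdorff_half_space R d.+1 d) mF openT) => //.
  by move=> x _; exact: continuous_imPhi.
have aA : {ae mu, forall x, F x -> `|a x| <= A}.
  apply: ae_imply ae_normal => x H Fx; apply: norm_derive_imPhi_le => //.
  by rewrite (outward_normal_unit (H Fx)).
have bB x : F x -> `|imPhi k x z| <= B by move=> _; exact: norm_imPhi_le.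
rewrite !imagingE; apply: le_trans (normc_le _ _) _.
have boundR := norm_Rintegral_pairing_sub_le cmu mF ma mb A0 B0 aA bB
  ig_R ih_R igR ihR gR hR.
have boundI := norm_Rintegral_pairing_sub_le cmu mF ma mb A0 B0 aA bB
  ig_I ih_I igI ihI gI hI.
apply: le_trans (lerD boundR boundI) _.
have -> : (A + B) * (delta * m) + (A + B) * (delta * m) = 2 * (A + B) * m * delta by ring.
by rewrite ler_pM2r// lerDl.
Qed.

Theorem theorem2p2 (R : realType) (d : nat)
    (Omega : set 'rV[R]_d.+1) (nu : 'rV[R]_d.+1 -> 'rV[R]_d.+1)
    (k : R) (f : 'rV[R]_d.+1 -> R)
    (n23 : d.+1 = 2%N \/ d.+1 = 3%N)
    (Omega_lip : bounded_lipschitz_domain Omega)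
    (nu_normal : outward_unit_normal Omega nu)
    (k_gt0 : 0 < k)
    (f_L2 : (f : caratheodory_type (@lebesgue_outer R d.+1) -> R)
              \in Lfun (lebesgue_Rn R d.+1) 2%:E)
    (f_supp : compact_support_in Omega f) :
  let u := wave Omega k f in
  let dudnu := normal_derivative nu u in
  exists2 C : R, 0 < C &
    forall (delta : R) (u_ dudnu_ : 'rV[R]_d.+1 -> R[i]),
      0 < delta ->
      L2 (surface R d) (frontier Omega) u_ ->
      L2 (surface R d) (frontier Omega) dudnu_ ->
      (L2norm (surface R d) (frontier Omega) (fun x => (u x - u_ x)%R)
         <= delta%:E)%E ->
      (L2norm (surface R d) (frontier Omega) (fun x => (dudnu x - dudnu_ x)%R)
         <= delta%:E)%E ->
      forall z : 'rV[R]_d.+1,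
        Normc.normc (imaging Omega nu k u dudnu z
                     - imaging Omega nu k u_ dudnu_ z) <= C * delta.
Proof.
have [K [cK KOmega fK]] := f_supp; have [mnu _] := nu_normal.
have [oOmega _ _ _ _] := Omega_lip.
have mF := frontier_caratheodory (@hausdorff_half_space R d.+1 d) Omega.
have clK : closed K by exact: (compact_closed (@norm_hausdorff _ _) cK).
have FK x : frontier Omega x -> ~ K x.
  move=> [_ nintx] Kx; apply: nintx; apply: open_nbhs_nbhs; split=> //.
  exact: KOmega.
have intf := integrable_source f_L2 cK.
have [mRe mdRe] := measurable_boundary_wave mF mnu clK FK
  (wave_Re k_gt0 oOmega f_L2 cK KOmega fK)
  (continuous_potential cK (C1pos_re_radial _ _) intf)
  (fun x v => derivable_potential cK (C1pos_re_radial _ _) intf (v := v)).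
have [mIm mdIm] := measurable_boundary_wave mF mnu clK FK
  (wave_Im k_gt0 oOmega f_L2 cK KOmega fK)
  (continuous_potential cK (C1pos_im_radial _ _) intf)
  (fun x v => derivable_potential cK (C1pos_im_radial _ _) intf (v := v)).
exact: (imaging_stability (g := wave Omega k f)
  (h := normal_derivative nu (wave Omega k f))
  n23 Omega_lip nu_normal k_gt0 mRe mIm mdRe mdIm).
Qed.
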